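(* Let $K\ge 1$ and let $R=((r_{ij}))$ be a $(K+1)\times(K+1)$ upper triangular replacement matrix with nonnegative entries and all row sums equal to one, with $(J+1)$ blocks. Assume that the colors are in increasing order and, moreover, that for every $j\in\{1,\dots,J\}$ with $r_{i_j}=r_{i_{j+1}}$ (where $r_k:=r_{kk}$) one has $\sum_{m=i_j}^{i_{j+1}-1} r_{m,i_{j+1}}>0$. Let $(\boldsymbol{C}_N)_{N\ge 0}$ be the urn process with replacement matrix $R$. Then there exist random variables $V_1,\dots,V_{J+1}$ such that, for $j=1,2,\dots,J+1$, as $N\to\infty$, $$\frac{\boldsymbol{C}^{(j)}_{N}}{N^{\lambda_j}(\log N)^{\nu_j}}\to \boldsymbol{\pi}^{(j)}V_j\quad\text{almost surely, as well as in } L^2,$$ where: (a) $V_{J+1}=1$; (b) if $r_1=0$, then $V_1=\boldsymbol{C}_{01}$ (the initial count of color $1$), and if $r_1>0$, then $V_1$ is a non-degenerate random variable; (c) for $j=2,3,\dots,J$, if $\nu_j=0$, then $V_j$ is a non-degenerate random variable; (d) for $j=2,3,\dots,J$, if $\nu_j>0$, then $$V_j=\frac{1}{\nu_j}\,\boldsymbol{\pi}^{(j-1)}\boldsymbol{\rho}^{(j-1)}\,V_{j-1}.$$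
   Context: **Urn process.** The urn has balls of $K+1$ colors. The initial counts form a non-random row vector $\boldsymbol{C}_0$ with strictly positive real entries summing to one. $R=((r_{ij}))$ is a non-random $(K+1)\times(K+1)$ matrix with nonnegative entries and every row sum equal to one (''balanced''). $\boldsymbol{C}_n$ is the row vector of counts of each color after the $n$-th trial, with entries $\boldsymbol{C}_{n1},\dots,\boldsymbol{C}_{n,K+1}$. At the $n$-th trial ($n=1,2,\dots$), given the past, color $i$ is drawn with probability $\boldsymbol{C}_{n-1,i}/n$; the drawn ball is returned, and if color $i$ was drawn then, for every $j$, $r_{ij}$ balls of color $j$ are added, i.e. $\boldsymbol{C}_n=\boldsymbol{C}_{n-1}+(\text{the } i\text{-th row of } R)$. (So the total count after $n$ trials is $n+1$.) ''Non-degenerate'' means not almost surely constant. **Running maxima and blocks.** Write $r_k=r_{kk}$ for the diagonal entries. Let $1=i_1<i_2<\dots<i_J<i_{J+1}=K+1$ be the indices of the (weak) running maxima of the diagonal: $r_{i_1}\le r_{i_2}\le\dots\le r_{i_{J+1}}$, and $r_k<r_{i_j}$ whenever $i_j<k<i_{j+1}$, $j=1,\dots,J$. (Since $R$ is upper triangular with row sums one, $r_{K+1}=1$ is the maximum possible diagonal value, so $K+1$ is always such an index.) For $j=1,\dots,J$ the colors $i_j,i_j+1,\dots,i_{j+1}-1$ form the $j$-th block, with leading index $i_j$; color $K+1$ alone forms the $(J+1)$-st block. **Increasing order.** The colors are in increasing order if for every $j=1,\dots,J$ and every $k$ with $i_j<k<i_{j+1}$ one has $\sum_{m=i_j}^{k-1}r_{mk}>0$.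 **Notation for blocks.** $\lambda_j=r_{i_j}$. $\nu_j=\#\{m: m<i_j,\ r_m=\lambda_j\}$. $R^{(j)}$ is the submatrix of $R$ with rows and columns indexed by the $j$-th block. $\boldsymbol{C}^{(j)}_n$ is the part of $\boldsymbol{C}_n$ corresponding to the $j$-th block. $\boldsymbol{\rho}^{(j)}$ ($1\le j\le J$) is the column vector consisting of the part of the $i_{j+1}$-th column of $R$ in the rows of the $j$-th block. $\boldsymbol{\pi}^{(j)}$ is the unique row vector with $\boldsymbol{\pi}^{(j)}R^{(j)}=\lambda_j\boldsymbol{\pi}^{(j)}$ and first coordinate $\boldsymbol{\pi}^{(j)}_1=1$ (unique since $\lambda_j$ is a simple, strictly largest eigenvalue of $R^{(j)}$). *)

(* Defs.v *)
From HB Require Import structures.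
From mathcomp Require Import all_boot all_order all_algebra.
From mathcomp Require Import all_classical all_reals all_analysis.
From mathcomp Require Import zify.

Set Implicit Arguments.
Unset Strict Implicit.
Unset Printing Implicit Defensive.

Import Order.TTheory GRing.Theory Num.Theory.
Import numFieldNormedType.Exports.

Local Open Scope classical_set_scope.
Local Open Scope ring_scope.

(* Colors are numbered from 0 to K (type 'I_K.+1) and blocks from 0 to J
   (type 'I_J.+1), so that color k and block j here are color k + 1 and
   block j + 1 in the usual 1-based numbering. The trials are numbered from 0
   as well: [draw n] is the color drawn at the (n + 1)-st trial, which takes
   the counts [C n] to [C n.+1]. *)

Section Urn.
Context {d : measure_display} {T : measurableType d} {R : realType}.
Context (P : probability T R) (K : nat).

Definition past (draw : nat -> T -> 'I_K.+1) (n : nat) : set (set T) :=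
  <<s [set A | exists m : nat, exists i : 'I_K.+1,
        (m < n)%N /\ A = draw m @^-1` [set i]] >>.

(* [urn_law] says that C n 0 i / n.+1 is a version of the conditional
   probability of [draw n = i] given the sigma-algebra [past draw n]; it is
   measurable for [past draw n] because C n is a function of the first n
   draws. *)
Record urn_process (Rm : 'M[R]_K.+1) (C0 : 'rV[R]_K.+1)
    (draw : nat -> T -> 'I_K.+1) (C : nat -> T -> 'rV[R]_K.+1) : Prop := {
  urn_draw_measurable : forall n i, measurable (draw n @^-1` [set i]);
  urn_init : forall w, C 0%N w = C0;
  urn_step : forall n w, C n.+1 w = C n w + row (draw n w) Rm;
  urn_law : forall n i (A : set T), past draw n A ->
    P (A `&` draw n @^-1` [set i]) =
    (\int[P]_(w in A) (C n w 0 i / n.+1%:R)%:E)%E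
}.

Definition nondegenerate_rv (V : T -> R) : Prop :=
  ~ exists c : R, {ae P, forall w, V w = c}.

Definition cvg_L2 (X : nat -> T -> R) (Y : T -> R) : Prop :=
  [/\ forall n, X n \in Lfun P 2%:E, Y \in Lfun P 2%:E &
      'N[P]_2%:E [EFin \o (X n \- Y)%R]%E @[n --> \oo] --> 0%E].

End Urn.

Section Blocks.
Context {R : realType} {K : nat} (Rm : 'M[R]_K.+1).
Context {J : nat} (lead : 'I_J.+1 -> 'I_K.+1).
Implicit Type j : 'I_J.+1.

Definition diag (k : 'I_K.+1) : R := Rm k k.

(* Only meaningful when j < J, respectively 0 < j. *)
Definition next_block j : 'I_J.+1 := inord j.+1.
Definition prev_block j : 'I_J.+1 := inord j.-1.

Definition running_maxima : Prop :=
  [/\ lead ord0 = ord0, lead ord_max = ord_max &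
      forall j, (j < J)%N ->
        [/\ (lead j < lead (next_block j))%N,
            diag (lead j) <= diag (lead (next_block j)) &
            forall k : 'I_K.+1, (lead j < k < lead (next_block j))%N ->
              diag k < diag (lead j)]].

Definition increasing_order : Prop :=
  forall j (k : 'I_K.+1), (j < J)%N -> (lead j < k < lead (next_block j))%N ->
    0 < \sum_(m < K.+1 | (lead j <= m < k)%N) Rm m k.

Definition linked_ties : Prop :=
  forall j, (j < J)%N -> diag (lead j) = diag (lead (next_block j)) ->
    0 < \sum_(m < K.+1 | (lead j <= m < lead (next_block j))%N)
          Rm m (lead (next_block j)).

Definition lambda j : R := diag (lead j).

Definition nu j : nat :=
  #|[pred m : 'I_K.+1 | (m < lead j)%N && (diag m == lambda j)]|.

Definition block_end j : nat :=
  if (j < J)%N then nat_of_ord (lead (next_block j)) else K.+1.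

(* Block j has [(block_pred j).+1] colors; the successor makes its leading
   coordinate available as [ord0]. *)
Definition block_pred j : nat := (block_end j - lead j)%N.-1.

Definition color_of j (a : 'I_((block_pred j).+1)) : 'I_K.+1 :=
  inord (lead j + a)%N.

Definition block_mat j : 'M[R]_((block_pred j).+1) :=
  mxsub (@color_of j) (@color_of j) Rm.

Definition block_part j (C : 'rV[R]_K.+1) : 'rV[R]_((block_pred j).+1) :=
  colsub (@color_of j) C.

Definition rho j : 'cV[R]_((block_pred j).+1) :=
  \col_a Rm (color_of a) (lead (next_block j)).

Definition is_pi j (p : 'rV[R]_((block_pred j).+1)) : Prop :=
  p *m block_mat j = lambda j *: p /\ p 0 ord0 = 1.

(* [is_pi_unique] proves that there is exactly one such vector. *)
Definition block_pi j : 'rV[R]_((block_pred j).+1) := xget 0 [set p | is_pi p].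

End Blocks.

Arguments next_block {J} j.
Arguments prev_block {J} j.

Definition norming {R : realType} (l : R) (v N : nat) : R :=
  N%:R `^ l * ln N%:R ^+ v.

Definition upper_triangular {R : realType} {n : nat} (A : 'M[R]_n) : Prop :=
  forall i j : 'I_n, (j < i)%N -> A i j = 0.

Lemma left_eigenvector_unique {R : realType} n (A : 'M[R]_n.+1) :
  upper_triangular A -> (forall k, k != ord0 -> A k k < A ord0 ord0) ->
  exists! p : 'rV[R]_n.+1, p *m A = A ord0 ord0 *: p /\ p 0 ord0 = 1.
Proof.
move=> utA ltA; set l := A ord0 ord0.
have ls0 (a : 'I_1) : lshift n a = ord0 :> 'I_n.+1.
  by rewrite ord1; exact: val_inj.
pose M : 'M[R]_(1 + n) := A - l%:M.
have ME a b : M a b = A a b - l *+ (a == b) by rewrite !mxE.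
have eM p : (p *m A = l *: p) <-> (p *m M = 0).
  rewrite /M mulmxBr mul_mx_scalar; split=> [->|/eqP]; first by rewrite subrr.
  by rewrite subr_eq0 => /eqP.
have ul0 : ulsubmx M = 0.
  apply/matrixP => a b.
  by rewrite [LHS]mxE [LHS]mxE ME !ls0 eqxx mulr1n subrr mxE.
have dl0 : dlsubmx M = 0.
  apply/matrixP => a b; rewrite [LHS]mxE [LHS]mxE ME !ls0 utA // mxE.
  by rewrite -val_eqE /= mulr0n subrr.
have uD : drsubmx M \in unitmx.
  rewrite unitmxE -det_tr det_trig.
    rewrite unitfE; apply/prodf_neq0 => a _.
    rewrite 3![fun_of_matrix _ _ _]mxE ME eqxx mulr1n.
    by rewrite subr_eq0 lt_eqF // ltA // -val_eqE.
  apply/is_trig_mxP => a b ab; rewrite 3![LHS]mxE ME utA /= ?add1n //.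
  by rewrite -val_eqE /= eqn_add2l gtn_eqF // mulr0n subrr.
pose q : 'rV[R]_(1 + n) := row_mx 1%:M (- (ursubmx M *m invmx (drsubmx M))).
have mulM (u : 'rV[R]_1) (v : 'rV[R]_n) :
    row_mx u v *m M = row_mx 0 (u *m ursubmx M + v *m drsubmx M).
  by rewrite -[M in LHS]submxK mul_row_block ul0 dl0 !mulmx0 addr0.
exists q; split.
  split; last first.
    by have : q 0 (lshift n 0) = 1 by [rewrite row_mxEl mxE]; rewrite ls0.
  by apply/eM; rewrite mulM mul1mx mulNmx mulmxKV // subrr row_mx0.
move=> p [/eM pM p0]; have p1 : lsubmx (p : 'rV_(1 + n)) = 1%:M.
  by apply/matrixP => a b; rewrite mxE ls0 !ord1 p0 mxE.
have pE : p = row_mx 1%:M (rsubmx (p : 'rV_(1 + n))) :> 'rV_(1 + n).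
  by rewrite -p1 hsubmxK.
move: pM; rewrite pE mulM mul1mx => /(congr1 (@rsubmx _ 1 1 n)).
rewrite row_mxKr linear0 => /eqP; rewrite addrC addr_eq0 => /eqP pD.
by rewrite /q -mulNmx -pD mulmxK.
Qed.

Lemma is_pi_unique {R : realType} K (Rm : 'M[R]_K.+1) J
    (lead : 'I_J.+1 -> 'I_K.+1) :
  upper_triangular Rm -> running_maxima Rm lead ->
  forall j, exists! p, @is_pi _ _ Rm _ lead j p.
Proof.
move=> utR [_ leadJ leadP] j.
have alt (a : 'I_(block_pred lead j).+1) :
    (a <= (block_end lead j - lead j).-1)%N by exact: (ltn_ord a).
have colE (a : 'I_(block_pred lead j).+1) :
    color_of a = (lead j + a)%N :> nat.
  rewrite /color_of inordK //; move: (nat_of_ord a) (alt a) => m.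
  have := ltn_ord (lead j); rewrite /block_end; case: ifP => jJ.
    have [+ _ _] := leadP j jJ; have := ltn_ord (lead (next_block j)); lia.
  lia.
have col0 : color_of (ord0 : 'I_(block_pred lead j).+1) = lead j.
  by apply: val_inj; rewrite /= colE addn0.
have -> : @is_pi _ _ Rm _ lead j = (fun p =>
    p *m block_mat Rm lead j = block_mat Rm lead j ord0 ord0 *: p
    /\ p 0 ord0 = 1).
  by apply/funext => p; rewrite /is_pi [block_mat _ _ _ _ _]mxE col0.
apply: left_eigenvector_unique => [a b ba|a a0].
  by rewrite mxE utR // !colE ltn_add2l.
rewrite !mxE col0; have a_gt0 : (0 < a)%N by rewrite lt0n.
case: (ltnP j J) => jJ.
  have [_ _] := leadP j jJ; apply.
  by rewrite colE; have := alt a; rewrite /block_end jJ; lia.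
have leadjE : lead j = K :> nat.
  suff -> : j = ord_max by rewrite leadJ.
  by apply: val_inj => /=; have := ltn_ord j; lia.
have := alt a; rewrite /block_end ltnNge jJ /= leadjE.
by move: a_gt0; move: (nat_of_ord a) => m; lia.
Qed.

Lemma is_pi_block_pi {R : realType} K (Rm : 'M[R]_K.+1) J
    (lead : 'I_J.+1 -> 'I_K.+1) :
  upper_triangular Rm -> running_maxima Rm lead ->
  forall j, is_pi Rm (block_pi Rm lead j).
Proof.
move=> utR leadP j; have [p [pP _]] := is_pi_unique utR leadP j.
by apply: (@xgetPex _ 0 [set p | is_pi Rm p]); exists p.
Qed.

(* Main.v *)
(* A leading color k whose diagonal entry l is a strict running maximum has a
   nonnegative right eigenvector v of R for l, supported on the colors up to k.
   The functional C_n v divided by prod_(i < n) (1 + l / (i + 1)) is a martingale;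
   its increments are bounded, so its variances telescope, and it converges almost
   surely and in L2. The limit is not constant as soon as the first draw has an
   effect, which it has unless l = 0 or v is constant. Every other color k
   satisfies, after normalisation by the right scale, a linear recursion
   u(n+1) = (1 - c_n g_n) u(n) + g_n s_n + noise, where s_n is the normalised inflow
   from the smaller colors, c_n -> c > 0 and the g_n sum to infinity; hence
   u -> lim s / c. For a color inside a block, g_n = 1 / (n + 1) and
   c = lambda_j - r_k, so the limits solve the equations that define pi. For a
   leading color tied with the previous one, g_n = 1 / ((n + 1) h_n) with h_n of
   order ln n, and c = nu_j, which is where the factor 1 / nu_j comes from. *)

(* All limits are proved on the scales [rise l n * harm n ^+ v], whose one-step ratios are explicit;
   passing to N^l (log N)^v at the end costs a factor 1 / Gamma(l + 1), which is built into V_j.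
   Tied blocks share l, so the factor cancels in the relation between V_j and V_(j-1), and it equals
   1 for l = 0 and l = 1, where V_j has a prescribed value. The obstacle for a color treated by the
   recursion is its noise: summing it requires a bound on the growth of the mean count, which is
   part of what is to be proved. Expectations obey the same recursion without noise, so the bound on
   the mean comes first; the noise then sums to a convergent martingale N -> W, and subtracting N -
   W leaves a recursion that one and the same inequality solves along paths and in L2 norm. The
   order and tie hypotheses give lambda_j < 1 before the last block, so the last block is never tied
   and V_(J+1) = 1. *)
Require Import Defs.
From HB Require Import structures.
From mathcomp Require Import all_boot all_order all_algebra.
From mathcomp Require Import all_classical all_reals all_analysis.
From mathcomp Require Import measurable_realfun ring lra zify.

Set Implicit Arguments.
Unset Strict Implicit.
Unset Printing Implicit Defensive.

Import Order.TTheory GRing.Theory Num.Theory.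
Import numFieldNormedType.Exports.

Local Open Scope classical_set_scope.
Local Open Scope ring_scope.

(** * Perturbed linear recursions *)

Section RealSequences.
Context {R : realType}.
Implicit Types (e g c s u : R ^nat) (l : R).

Lemma series_at0 u : series u 0 = 0.
Proof. by rewrite /series /= big_geq. Qed.

(* Stated as an inequality so that it applies both to absolute values along a
   path and to L2 norms. *)
Lemma rec_le_cvg0 e g c s l :
  0 < l -> (forall n, 0 <= e n) -> (forall n, 0 <= g n) ->
  (forall n, 0 <= 1 - c n * g n) ->
  c @ \oo --> l -> s @ \oo --> 0 -> series g @ \oo --> +oo ->
  (forall n, e n.+1 <= (1 - c n * g n) * e n + g n * s n) ->
  e @ \oo --> 0.
Proof.
move=> l0 e0 g0 cg0 cl s0 gy erec.
pose k := l / 2.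
have k0 : 0 < k by rewrite divr_gt0.
apply/cvgrPdist_le => d d0; pose d2 := d / 2.
have d20 : 0 < d2 by rewrite divr_gt0.
have [N _ HN] : \forall n \near \oo, k <= c n /\ s n <= k * d2.
  near=> n; split.
    near: n; apply: (cvgr_ge l) => //.
    by rewrite /k; lra.
  near: n; apply: (cvgr_le 0) => //.
  by rewrite mulr_gt0.
(* The excess over the level d/2. From [N] on the recursion keeps that level, so the excess can only
   contract, by at least exp(- k g_n) per step, and the divergence of the series of g_n drives it to
   0. *)
pose f n := Num.max (e n - d2) 0.
have f0 n : 0 <= f n by rewrite le_max lexx orbT.
have frec n : (N <= n)%N -> f n.+1 <= expR (- (k * g n)) * f n.
  move=> Nn; have [kc sk] := HN n Nn.
  have H1 : f n.+1 <= (1 - c n * g n) * f n.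
    rewrite ge_max; apply/andP; split; last by rewrite mulr_ge0.
    apply: (@le_trans _ _ ((1 - c n * g n) * (e n - d2))); last first.
      by rewrite ler_wpM2l // le_max lexx.
    have := erec n; have : g n * s n <= g n * (k * d2) by rewrite ler_wpM2l.
    have : 0 <= (c n - k) * (g n * d2).
      by rewrite mulr_ge0 ?subr_ge0 // mulr_ge0 // ltW.
    by rewrite mulrBl mulrBr mulrBl; lra.
  apply: le_trans H1 _; rewrite ler_wpM2r //.
  apply: (@le_trans _ _ (1 - k * g n)); last exact: expR_ge1Dx.
  by rewrite lerB // ler_wpM2r.
have fle n : f (N + n)%N <= expR (- (k * (series g (N + n)%N - series g N))) * f N.
  elim: n => [|n IH]; first by rewrite addn0 subrr mulr0 oppr0 expR0 mul1r.
  rewrite addnS seriesSr; apply: le_trans (frec _ _) _; first exact: leq_addr.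
  rewrite [X in _ <= expR X * _](_ : _ = - (k * g (N + n)%N)
     + - (k * (series g (N + n)%N - series g N))); last by ring.
  by rewrite expRD -mulrA ler_wpM2l ?expR_ge0.
have fN : (fun n => expR (- (k * (series g n - series g N))) * f N) @ \oo --> 0.
  rewrite -(mul0r (f N)); apply: cvgM; last exact: cvg_cst.
  apply: (@cvg_comp _ _ _ (fun n => k * (series g n - series g N))
    (fun x => expR (- x)) \oo +oo).
    apply/cvgryPge => A; near=> n.
    rewrite mulrC -ler_pdivrMr // lerBrDr.
    by near: n; exact: cvgry_ge.
  exact: cvgr_expR.
near=> n; rewrite sub0r normrN ger0_norm //.
have : f n <= d2.
  have Nn : (N <= n)%N by near: n; exists N.
  rewrite -(subnKC Nn); apply: le_trans (fle _) _; rewrite subnKC //.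
  by near: n; apply: (cvgr_le 0).
have : e n - d2 <= f n by rewrite le_max lexx.
by rewrite /d2; lra.
Unshelve. all: by end_near. Qed.

(** Centring at t / l turns the inflow into s_n - c_n t / l, which tends to 0, so [rec_le_cvg0]
    applies to the absolute error. *)
Lemma rec_cvg u g c s l (t : R) :
  0 < l -> (forall n, 0 <= g n) ->
  (forall n, 0 <= 1 - c n * g n) ->
  c @ \oo --> l -> s @ \oo --> t -> series g @ \oo --> +oo ->
  (forall n, u n.+1 = (1 - c n * g n) * u n + g n * s n) ->
  u @ \oo --> t / l.
Proof.
move=> l0 g0 cg0 cl st gy urec.
have l_neq0 : l != 0 by rewrite gt_eqF.
suff H : `|u n - t / l| @[n --> \oo] --> 0.
  by apply: cvg_zero; apply: norm_cvg0; exact: H.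
apply: (@rec_le_cvg0 _ g c (fun n => `|s n - c n * (t / l)|) l) => //.
- suff /cvg_norm : (fun n => s n - c n * (t / l)) @ \oo --> (0 : R).
    by rewrite normr0.
  rewrite -(subrr t) [X in _ --> _ - X](_ : t = l * (t / l)); last first.
    by rewrite mulrC divfK.
  by apply: cvgB => //; apply: cvgM => //; exact: cvg_cst.
- move=> n; rewrite urec.
  rewrite (_ : _ - _ = (1 - c n * g n) * (u n - t / l)
    + g n * (s n - c n * (t / l))); last by ring.
  apply: (le_trans (ler_normD _ _)).
  by rewrite 2!normrM (ger0_norm (cg0 n)) (ger0_norm (g0 n)).
Qed.


(* The growth rate n^l / Gamma(l+1), as an exact product. *)
Definition rise (l : R) (n : nat) : R := \prod_(0 <= i < n) (1 + l / i.+1%:R).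

(** Stands in for ln n; the extra 1 keeps it at least 1 from n = 0 on, so that dividing by it is
    always allowed. *)
Definition harm (n : nat) : R := 1 + series harmonic n.

Lemma rise0 l : rise l 0 = 1.
Proof. by rewrite /rise big_geq. Qed.

Lemma riseS l n : rise l n.+1 = rise l n * (1 + l / n.+1%:R).
Proof. by rewrite /rise big_nat_recr. Qed.

Lemma rise_gt0 l n : 0 <= l -> 0 < rise l n.
Proof.
move=> l0; elim: n => [|n IH]; first by rewrite rise0.
by rewrite riseS mulr_gt0 // ltr_pwDl // divr_ge0.
Qed.

Lemma rise_exp0 n : rise 0 n = 1.
Proof. by elim: n => [|n IH]; rewrite ?rise0 // riseS IH mul0r addr0 mulr1. Qed.

Lemma rise1E n : rise 1 n = n.+1%:R.
Proof.
elim: n => [|n IH]; first by rewrite rise0.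
rewrite riseS IH div1r mulrDr mulr1 divff ?pnatr_eq0 //.
by rewrite -[in RHS](addn1 n.+1) natrD.
Qed.

Lemma harmS n : harm n.+1 = harm n + n.+1%:R^-1.
Proof. by rewrite /harm seriesSr addrA. Qed.

Lemma harm_ge1 n : 1 <= harm n.
Proof.
elim: n => [|n IH]; first by rewrite /harm series_at0 addr0.
by rewrite harmS (le_trans IH) // lerDl invr_ge0.
Qed.

Lemma harm_gt0 n : 0 < harm n.
Proof. exact: lt_le_trans (harm_ge1 n). Qed.

Lemma series_harmonic_ge n : ln n.+1%:R <= series harmonic n :> R.
Proof.
elim: n => [|n IH]; first by rewrite ln1 series_at0.
rewrite seriesSr -lerBlDl; apply: le_trans (_ : ln n.+2%:R - ln n.+1%:R <= _).
  by rewrite lerB.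
rewrite -ln_div ?posrE //.
rewrite (_ : _ / _ = 1 + n.+1%:R^-1).
  by rewrite le_ln1Dx // (lt_trans (ltrN10 _)) // invr_gt0.
by rewrite -(natr1 n.+1) mulrDl divff ?mul1r // pnatr_eq0.
Qed.

Lemma series_harmonic_le n : series harmonic n.+1 <= 1 + ln n.+1%:R :> R.
Proof.
elim: n => [|n IH].
  by rewrite seriesSr series_at0 ln1 /= invr1 addr0 add0r.
rewrite seriesSr -lerBrDr; apply: le_trans IH _.
rewrite -addrA lerD2l lerBrDr -lerBrDl /=.
have n2 : n.+2%:R != 0 :> R by rewrite pnatr_eq0.
rewrite -lerN2 opprB -ln_div ?posrE //.
rewrite (_ : _ / _ = 1 + - n.+2%:R^-1).
  by rewrite le_ln1Dx // ltrN2 invf_lt1 // ltr1n.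
by apply: (mulIf n2); rewrite divfK // mulrDl mulNr mulVf // mul1r -(natr1 n.+1) addrK.
Qed.

Lemma cvg_series_harmonic : series (@harmonic R) @ \oo --> +oo.
Proof.
apply: nondecreasing_dvgn_lt; last exact: dvg_harmonic.
by apply: nondecreasing_series => n _ _; exact: harmonic_ge0.
Qed.

Lemma cvg_harm : harm @ \oo --> +oo.
Proof.
apply/cvgryPge => A; near=> n; rewrite /harm -lerBlDl.
by near: n; apply: cvgry_ge; exact: cvg_series_harmonic.
Unshelve. all: by end_near. Qed.

Lemma cvg_ln_natr : (fun n => ln n%:R : R) @ \oo --> +oo.
Proof.
apply/cvgryPge => A; near=> n.
have -> : n = n.-1.+1 by rewrite prednK //; near: n; exact: nbhs_infty_gt.
rewrite -(lerD2l 1); apply: le_trans (series_harmonic_le _).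
rewrite prednK; last by near: n; exact: nbhs_infty_gt.
by near: n; apply: cvgry_ge; exact: cvg_series_harmonic.
Unshelve. all: by end_near. Qed.

Lemma cvg_harm_ln : (fun n => harm n / ln n%:R : R) @ \oo --> (1 : R).
Proof.
apply: (@squeeze_cvgr _ _ _ _ (cst 1) (fun n => 1 + 2 / ln n%:R)).
- near=> n.
  have n0 : n = n.-1.+1 by rewrite prednK //; near: n; exact: nbhs_infty_gt.
  have l0 : 0 < ln n%:R :> R by near: n; exact: cvgry_gt cvg_ln_natr 0.
  rewrite ler_pdivlMr // mul1r; apply/andP; split.
    apply: le_trans (_ : ln n.+1%:R <= _).
      by rewrite ler_ln ?posrE ?ltr0n // ?ler_nat // n0.
    by rewrite (le_trans (series_harmonic_ge _)) // /harm lerDr.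
  rewrite ler_pdivrMr // mulrDl mul1r divfK ?gt_eqF //.
  have := series_harmonic_le n.-1; rewrite -n0 /harm; lra.
- exact: cvg_cst.
- rewrite -[X in _ --> X](addr0 1); apply: cvgD; first exact: cvg_cst.
  rewrite -[X in _ --> X](mulr0 2); apply: cvgM; first exact: cvg_cst.
  apply/(gtr0_cvgV0 (f := fun n => ln n%:R)); last exact: cvg_ln_natr.
  exact: cvgry_gt cvg_ln_natr 0.
Unshelve. all: by end_near. Qed.

(* Convexity of [expR] between [0] and [ln (1 + x)]. *)
Lemma powR_le_1Dx (l x : R) : 0 <= l <= 1 -> 0 <= x -> (1 + x) `^ l <= 1 + l * x.
Proof.
move=> /andP[l0 l1] x0; have x1 : 0 < 1 + x by rewrite ltr_pwDl.
have lt01 : Itv.spec (@Itv.num_sem R) (Itv.Real `[0%Z, 1%Z]) l.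
  by rewrite /Itv.num_sem /= num_real in_itv/= l0 l1.
have := @convex_expR R (Itv.mk lt01) (ln (1 + x)) 0.
rewrite !convRE /= expR0 mulr0 addr0 lnK ?posrE // => H.
rewrite /powR gt_eqF //; apply: le_trans H _; rewrite /unstable.onem le_eqVlt.
apply/orP; left; apply/eqP; ring.
Qed.

(** Dividing by (n + 1)^l rather than n^l gives a nondecreasing quotient, by [powR_le_1Dx], that
    starts at 1 and is bounded by e^l; hence a positive limit. The shift from n + 1 to n is undone
    at the end. *)
Lemma cvg_rise l : 0 <= l <= 1 ->
  exists2 G : R, 0 < G & (fun n => rise l n / n%:R `^ l) @ \oo --> G.
Proof.
move=> /[dup] l01 /andP[l0 l1].
pose q n := rise l n / n.+1%:R `^ l.
have n1 n : 0 < n.+1%:R `^ l :> R by rewrite powR_gt0.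
have rise_ge0 n : 0 <= rise l n by rewrite ltW // rise_gt0.
have qS n : q n <= q n.+1.
  rewrite ler_pdivlMr // mulrAC ler_pdivrMr // riseS -mulrA ler_wpM2l //.
  rewrite (_ : n.+2%:R = (1 + n.+1%:R^-1) * n.+1%:R); last first.
    by rewrite mulrDl mul1r mulVf ?pnatr_eq0 // natr1.
  rewrite powRM //.
  by rewrite ler_wpM2r ?powR_ge0 // powR_le_1Dx ?invr_ge0.
have q_nd : nondecreasing_seq q by apply/nondecreasing_seqP.
have rle n : rise l n <= expR (l * series harmonic n).
  elim: n => [|n IH]; first by rewrite rise0 series_at0 mulr0 expR0.
  rewrite riseS seriesSr [X in _ <= expR X]mulrDr expRD ler_pM //.
    by rewrite addr_ge0 // divr_ge0.
  exact: expR_ge1Dx.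
have qub n : q n <= expR l.
  rewrite ler_pdivrMr //; apply: le_trans (_ : rise l n.+1 <= _).
    by rewrite riseS ler_peMr // lerDl divr_ge0.
  apply: le_trans (rle _) _.
  rewrite /powR pnatr_eq0 /= -expRD ler_expR -{2}(mulr1 l) -mulrDr ler_wpM2l //.
  exact: series_harmonic_le.
have qc : cvgn q.
  by apply: nondecreasing_is_cvgn => //; exists (expR l) => _ [n _ <-].
exists (limn q).
  apply: (@lt_le_trans _ _ (q 0%N)); last exact: nondecreasing_cvgn_le.
  by rewrite /q rise0 powR1 divr1.
have pc : (fun n => (1 + n%:R^-1) `^ l) @ \oo --> (1 : R).
  apply: (@squeeze_cvgr _ _ _ _ (cst 1) (fun n => 1 + l * n%:R^-1)).
  - near=> n; rewrite powR_le_1Dx ?invr_ge0 // andbT.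
    rewrite [leLHS](_ : _ = 1 `^ l); last by rewrite powR1.
    by rewrite ge0_ler_powR // ?nnegrE ?addr_ge0 ?invr_ge0 // lerDl invr_ge0.
  - exact: cvg_cst.
  - rewrite -[X in _ --> X](addr0 1); apply: cvgD; first exact: cvg_cst.
    rewrite -[X in _ --> X](mulr0 l); apply: cvgM; first exact: cvg_cst.
    by rewrite -(cvg_shiftS (fun n => n%:R^-1 : R)); exact: cvg_harmonic.
rewrite -(mulr1 (limn q)); apply: cvg_trans (cvgM qc pc); apply: near_eq_cvg.
near=> n; have n0 : (0 < n)%N by near: n; exact: nbhs_infty_gt.
have n0R : n%:R != 0 :> R by rewrite pnatr_eq0 -lt0n.
have n1R : 0 < n.+1%:R `^ l :> R by [].
rewrite /q /= (_ : 1 + n%:R^-1 = n.+1%:R * n%:R^-1); last first.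
  by rewrite -natr1 mulrDl divff // mul1r.
rewrite powRM ?invr_ge0 // -[n%:R^-1]powR_inv1 // -powRrM mulN1r powRN.
by rewrite mulrA divfK // gt_eqF.
Unshelve. all: by end_near. Qed.
End RealSequences.

(** * Norming scales *)

(* [drift w r x] says that [r n = 1 + (x + o(1)) w n]. *)
Definition drift {R : realType} (w r : R ^nat) (x : R) : Prop :=
  (fun n => (r n - 1) / w n) @ \oo --> x.

Section Drift.
Context {R : realType} (w : R ^nat).
Hypotheses (w_neq0 : forall n, w n != 0) (w0 : w @ \oo --> 0).
Implicit Types (r s : R ^nat) (x y : R).

Lemma drift_cvg1 r x : drift w r x -> r @ \oo --> (1 : R).
Proof.
move=> rx; rewrite (_ : r = fun n => 1 + (r n - 1) / w n * w n).
  rewrite -[X in _ --> X](addr0 1); apply: cvgD; first exact: cvg_cst.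
  by rewrite -[X in _ --> X](mulr0 x); exact: cvgM.
by apply/funext => n; rewrite divfK // addrC subrK.
Qed.

Lemma driftM r s x y : drift w r x -> drift w s y ->
  drift w (fun n => r n * s n) (x + y).
Proof.
move=> rx sy; rewrite /drift.
rewrite (_ : (fun n => _) =
    fun n => (r n - 1) / w n * s n + (s n - 1) / w n).
  apply: cvgD => //; rewrite -[X in _ --> X]mulr1; apply: cvgM => //.
  exact: drift_cvg1 sy.
by apply/funext => n; ring.
Qed.

Lemma driftV r x : (forall n, r n != 0) -> drift w r x ->
  drift w (fun n => (r n)^-1) (- x).
Proof.
move=> r_neq0 rx; rewrite /drift.
rewrite (_ : (fun n => _) = fun n => - ((r n - 1) / w n) * (r n)^-1).
  rewrite -[X in _ --> X]mulr1; apply: cvgM; first exact: cvgN.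
  by rewrite -[X in _ --> X]invr1; apply: cvgV; [exact: oner_neq0|exact: drift_cvg1 rx].
by apply/funext => n; field; rewrite w_neq0 r_neq0.
Qed.

Lemma driftX r x k : drift w r x -> drift w (fun n => r n ^+ k) (k%:R * x).
Proof.
move=> rx; elim: k => [|k IH].
  rewrite mul0r /drift (_ : (fun n => _) = cst 0); first exact: cvg_cst.
  by apply/funext => n; rewrite expr0 subrr mul0r.
rewrite -natr1 mulrDl mul1r addrC.
rewrite (_ : (fun n => _) = fun n => r n * r n ^+ k); first exact: driftM.
by apply/funext => n; rewrite exprS.
Qed.

End Drift.

Section Scales.
Context {R : realType}.
Implicit Types (l r : R) (v : nat).

(** Two orders of magnitude for the deviation of a one-step ratio from 1: the factor [rise] moves at
    order [inv1], the powers of [harm] only at the smaller order [invh], so that [inv1] does not see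
    them ([drift_harm]). *)
Let inv1 : R ^nat := fun n => n.+1%:R^-1.
Let invh : R ^nat := fun n => (n.+1%:R * harm n.+1)^-1.

(* A substitute for n^l ln^v n whose consecutive ratios are explicit. *)
Definition scale l v (n : nat) : R := rise l n * harm n ^+ v.

Lemma scale_gt0 l v n : 0 <= l -> 0 < scale l v n.
Proof. by move=> l0; rewrite mulr_gt0 ?rise_gt0 // exprn_gt0 // harm_gt0. Qed.

Let inv1_gt0 n : 0 < inv1 n. Proof. by rewrite invr_gt0. Qed.
Let inv1_neq0 n : inv1 n != 0. Proof. by rewrite gt_eqF. Qed.
Let invh_gt0 n : 0 < invh n.
Proof. by rewrite invr_gt0 mulr_gt0 ?harm_gt0. Qed.
Let invh_neq0 n : invh n != 0. Proof. by rewrite gt_eqF. Qed.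
Let harm_neq0 n : harm n != 0 :> R. Proof. by rewrite gt_eqF // harm_gt0. Qed.

Let n1_neq0 n : 1 + n%:R != 0 :> R.
Proof. by rewrite addrC natr1 pnatr_eq0. Qed.

Let cvg_harmV : (fun n => (harm n)^-1 : R) @ \oo --> (0 : R).
Proof.
apply/(gtr0_cvgV0 (f := harm)); last exact: cvg_harm.
by apply: nearW => n; exact: harm_gt0.
Qed.

Let cvg_harmSV : (fun n => (harm n.+1)^-1 : R) @ \oo --> (0 : R).
Proof. by rewrite (cvg_shiftS (fun n => (harm n)^-1 : R)). Qed.

Let inv1_0 : inv1 @ \oo --> 0. Proof. exact: cvg_harmonic. Qed.

Let invh_0 : invh @ \oo --> 0.
Proof.
rewrite (_ : invh = fun n => inv1 n * (harm n.+1)^-1).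
  by rewrite -(mulr0 0); exact: cvgM.
by apply/funext => n; rewrite /invh invfM.
Qed.

(** The discrete form of the integral of 1 / (x ln x), which is ln ln x. The factor 2 pays for
    replacing [harm n] by [harm n.+1] in a denominator. *)
Lemma cvg_series_invh : series invh @ \oo --> +oo.
Proof.
have le n : ln (harm n) <= 2 * series invh n.
  elim: n => [|n IH].
    by rewrite series_at0 mulr0 /harm series_at0 addr0 ln1.
  rewrite seriesSr mulrDr -lerBlDl.
  apply: le_trans (_ : ln (harm n.+1) - ln (harm n) <= _); first by rewrite lerB.
  rewrite -ln_div ?posrE ?harm_gt0 //.
  have -> : harm n.+1 / harm n = 1 + (n.+1%:R * harm n)^-1 :> R.
    rewrite harmS; field.
    by rewrite ?n1_neq0 ?harm_neq0.
  apply: le_trans (le_ln1Dx _) _.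
    by rewrite (lt_trans (ltrN10 _)) // invr_gt0 mulr_gt0 // harm_gt0.
  rewrite /invh !invfM mulrCA ler_wpM2l ?invr_ge0 //.
  rewrite -[2]invrK -invfM lef_pV2 ?posrE ?mulr_gt0 ?invr_gt0 ?harm_gt0 //.
  rewrite ler_pdivrMl // harmS mulr2n mulrDl mul1r lerD2l.
  by rewrite (le_trans _ (harm_ge1 n)) // invf_le1 // ler1n.
apply/cvgryPge => A; near=> n.
suff : 2 * A <= 2 * series invh n by rewrite ler_pM2l.
apply: le_trans (le n).
rewrite -ler_expR lnK ?posrE ?harm_gt0 //.
by near: n; exact: cvgry_ge cvg_harm _.
Unshelve. all: by end_near. Qed.

Let drift_lin l : drift inv1 (fun n => 1 + l / n.+1%:R) l.
Proof.
rewrite /drift (_ : (fun n => _) = cst l); first exact: cvg_cst.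
by apply/funext => n; rewrite addrAC subrr add0r mulfK.
Qed.

Let drift_harm : drift inv1 (fun n => harm n.+1 / harm n) 0.
Proof.
rewrite /drift (_ : (fun n => _) = fun n => (harm n)^-1 : R) //.
apply/funext => n; rewrite harmS /inv1; field.
by rewrite ?n1_neq0 ?harm_neq0.
Qed.

Let lin_neq0 l n : 0 <= l -> 1 + l / n.+1%:R != 0.
Proof. by move=> l0; rewrite gt_eqF // ltr_pwDl // divr_ge0. Qed.

Let scaleS l v n :
  scale l v n.+1 = scale l v n * ((1 + l / n.+1%:R) * (harm n.+1 / harm n) ^+ v).
Proof.
rewrite /scale riseS expr_div_n; field.
by rewrite ?n1_neq0 ?harm_neq0 ?expf_neq0.
Qed.

Let drift_scale l v :
  drift inv1 (fun n => (1 + l / n.+1%:R) * (harm n.+1 / harm n) ^+ v) l.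
Proof.
have : drift inv1 (fun n => (1 + l / n.+1%:R) * (harm n.+1 / harm n) ^+ v)
    (l + v%:R * 0).
  by apply: driftM => //; exact: driftX.
by rewrite mulr0 addr0.
Qed.

Let fac_neq0 l v n : 0 <= l ->
  (1 + l / n.+1%:R) * (harm n.+1 / harm n) ^+ v != 0.
Proof.
by move=> l0; rewrite mulf_neq0 ?lin_neq0 // expf_neq0 // mulf_neq0 // invr_neq0.
Qed.

(** The ratio itself solves a recursion with zero inflow and c = l' - l > 0, so [rec_cvg] gives the
    limit without comparing powers with logarithms. *)
Lemma cvg_scale_ratio l l' v : 0 <= l -> l < l' ->
  (fun n => scale l v n / scale l' 0 n) @ \oo --> 0.
Proof.
move=> l0 ll'; have l'0 : 0 <= l' by rewrite ltW // (le_lt_trans l0).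
pose r n := (1 + l / n.+1%:R) * (harm n.+1 / harm n) ^+ v /
  (1 + l' / n.+1%:R).
have f0 a n : 0 <= a -> 0 <= 1 + a / n.+1%:R by move=> a0; rewrite addr_ge0 // divr_ge0.
have r0 n : 0 <= r n.
  rewrite divr_ge0 ?f0 // mulr_ge0 ?f0 // exprn_ge0 // divr_ge0 //.
    exact/ltW/harm_gt0.
  exact/ltW/harm_gt0.
have rd : drift inv1 r (l - l').
  apply: driftM => //; apply: driftV => // n; exact: lin_neq0.
rewrite -(mul0r (l' - l)^-1).
apply: (@rec_cvg _ _ inv1 (fun n => - ((r n - 1) / inv1 n)) (cst 0)).
- by rewrite subr_gt0.
- by move=> n; exact: ltW.
- by move=> n; rewrite mulNr divfK // opprK addrC subrK.
- by rewrite -(opprB l l'); exact: cvgN.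
- exact: cvg_cst.
- exact: cvg_series_harmonic.
- move=> n; rewrite mulNr divfK // mulr0 addr0 opprK (addrC 1) subrK.
  rewrite [in LHS]scaleS [in X in _ / X]scaleS expr0 mulr1 /r.
  by rewrite invfM; ring.
Qed.

Lemma cvg_scaleS_ratio l v : 0 <= l ->
  (fun n => scale l v n / scale l v.+1 n) @ \oo --> 0.
Proof.
move=> l0; rewrite (_ : (fun n => _) = fun n => (harm n)^-1 : R) //.
apply/funext => n; rewrite /scale exprS; field.
by rewrite harm_neq0 expf_neq0 // gt_eqF // rise_gt0.
Qed.

(** The two limits that [urn_step_cvg] asks for when a color with diagonal entry r and its inflow
    have the same scale: c = l - r, with steps 1 / (n + 1). *)
Lemma scale_step_same l r v : 0 <= l ->
  (fun n => (1 - (1 + r / n.+1%:R) * (scale l v n / scale l v n.+1)) / n.+1%:R^-1)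
    @ \oo --> l - r /\
  (fun n => scale l v n / (n.+1%:R * scale l v n.+1) / n.+1%:R^-1) @ \oo --> (1 : R).
Proof.
move=> l0; pose s n := (1 + l / n.+1%:R) * (harm n.+1 / harm n) ^+ v.
have s_neq0 n : s n != 0 by exact: fac_neq0.
have sV : drift inv1 (fun n => (s n)^-1) (- l).
  by apply: driftV => //; exact: drift_scale.
have sE n : scale l v n / scale l v n.+1 = (s n)^-1.
  by rewrite scaleS invfM mulrA divff ?mul1r // gt_eqF // scale_gt0.
split.
  rewrite -opprB; rewrite (_ : (fun n => _) = fun n =>
      - (((1 + r / n.+1%:R) * (s n)^-1 - 1) / inv1 n)).
    by apply: cvgN; exact: driftM.
  by apply/funext => n; rewrite sE /inv1; ring.
rewrite (_ : (fun n => _) = fun n => (s n)^-1); first exact: drift_cvg1 sV.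
apply/funext => n; rewrite -sE.
by field; rewrite gt_eqF ?scale_gt0 //= addrC natr1 pnatr_eq0.
Qed.

(** The same two limits when the color carries one more logarithm than its inflow. Its own diagonal
    entry is l, so the [rise] factors cancel exactly and only (h_n / h_(n+1))^(v+1) is left, each
    factor of which has drift -1 relative to [invh]; this gives c = v + 1. *)
Lemma scale_step_next l v : 0 <= l ->
  (fun n => (1 - (1 + l / n.+1%:R) * (scale l v.+1 n / scale l v.+1 n.+1)) / invh n)
    @ \oo --> (v.+1%:R : R) /\
  (fun n => scale l v n / (n.+1%:R * scale l v.+1 n.+1) / invh n) @ \oo --> (1 : R).
Proof.
move=> l0; pose t n : R := harm n / harm n.+1.
have td : drift invh t (-1).
  rewrite /drift (_ : (fun n => _) = cst (-1)); first exact: cvg_cst.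
  apply/funext => n; rewrite /t /invh.
  rewrite (_ : harm n = harm n.+1 - n.+1%:R^-1); last by rewrite harmS addrK.
  by rewrite /cst; field; rewrite ?n1_neq0 ?harm_neq0.
have tX k : drift invh (fun n => t n ^+ k) (k%:R * -1) by exact: driftX.
have r_neq0 n : rise l n != 0 by rewrite gt_eqF // rise_gt0.
split.
  rewrite (_ : (fun n => _) = fun n => - ((t n ^+ v.+1 - 1) / invh n)).
    by have /cvgN := tX v.+1; rewrite mulrN1 opprK.
  apply/funext => n; rewrite -[RHS]mulNr opprB; congr ((1 - _) / _).
  rewrite /scale riseS /t expr_div_n.
  have := lin_neq0 n l0; set A := 1 + _ => A0.
  have : harm n.+1 ^+ v.+1 != 0 :> R by rewrite expf_neq0.
  by set B := _ ^+ _ => B0; field; rewrite A0 B0 r_neq0.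
have fV : (fun n => (1 + l / n.+1%:R)^-1) @ \oo --> (1 : R).
  have : drift inv1 (fun n => (1 + l / n.+1%:R)^-1) (- l).
    by apply: driftV => // n; exact: lin_neq0.
  exact: drift_cvg1.
rewrite -(mulr1 1) (_ : (fun n => _) = fun n => (1 + l / n.+1%:R)^-1 * t n ^+ v).
  by apply: cvgM => //; exact: drift_cvg1 (tX v).
apply/funext => n; rewrite /scale riseS /t /invh expr_div_n exprS !invfM !invrK.
have h1 := harm_neq0 n.+1; have h2 := lin_neq0 n l0.
have h3 : harm n.+1 ^+ v != 0 :> R by rewrite expf_neq0.
set A := 1 + _ in h2 *; set B := harm n.+1 in h1 h3 *; set C := B ^+ v in h3 *.
by field; rewrite h1 h2 h3 r_neq0 n1_neq0.
Qed.

End Scales.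

(** * Convergence almost surely and in L2 *)

Section L2norm.
Context {d : measure_display} {T : measurableType d} {R : realType}.
Variable P : probability T R.
Implicit Types (f g : T -> R) (X Y : nat -> T -> R).

Local Notation L2 := (Lfun P 2%:E).

Definition norm2 f : R := fine 'N[P]_2%:E[EFin \o f]%E.

Lemma L2D f g : f \in L2 -> g \in L2 -> (fun w => f w + g w) \in L2.
Proof. exact: (Lfun_addr_closed P (lee1n 2)).2. Qed.

Lemma L2Z a f : f \in L2 -> (fun w => a * f w) \in L2.
Proof.
move=> fL; have := Lfun_scale a (lee1n 2) fL.
by rewrite (_ : a \o* f = fun w => a * f w) //; apply/funext => w /=; rewrite mulrC.
Qed.

Lemma L2B f g : f \in L2 -> g \in L2 -> (fun w => f w - g w) \in L2.
Proof.
move=> fL /(L2Z (-1)) gL; have := L2D fL gL.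
by under eq_fun do rewrite mulN1r.
Qed.

Lemma L2_cst c : (fun _ : T => c) \in L2.
Proof. exact: (Lfun_cst P c 2). Qed.

Lemma L2_measurable f : f \in L2 -> measurable_fun setT f.
Proof. by rewrite inE => /andP[/[!inE]]. Qed.

Lemma L2_integrable f : f \in L2 -> P.-integrable setT (EFin \o f).
Proof.
by move=> fL; apply/Lfun1_integrable; apply: Lfun_subset12 fL; exact: fin_num_measure.
Qed.

Lemma norm2_EFin f : f \in L2 -> (norm2 f)%:E = 'N[P]_2%:E[EFin \o f]%E.
Proof.
by move=> fL; have := @finite_norm_fine _ _ _ P 2%:E (lee1n 2) (Lfun_Sub (lee1n 2) fL).
Qed.

Lemma norm2_ge0 f : 0 <= norm2 f.
Proof. by rewrite fine_ge0 // Lnorm_ge0. Qed.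

Lemma norm2D f g : f \in L2 -> g \in L2 ->
  norm2 (fun w => f w + g w) <= norm2 f + norm2 g.
Proof.
move=> fL gL; rewrite -lee_fin EFinD !norm2_EFin ?L2D //.
exact: (eminkowski P (L2_measurable fL) (L2_measurable gL) (lee1n 2)).
Qed.

Lemma norm2Z a f : f \in L2 -> norm2 (fun w => a * f w) = `|a| * norm2 f.
Proof.
move=> fL; apply: EFin_inj; rewrite EFinM !norm2_EFin ?L2Z //.
exact: (LnormZ (Lfun_Sub (lee1n 2) fL)).
Qed.

Lemma norm2_sqr f : f \in L2 -> norm2 f ^+ 2 = \int[P]_w (f w ^+ 2).
Proof.
move=> fL; apply: EFin_inj.
have -> : (norm2 f ^+ 2)%:E = ('N[P]_2%:E[EFin \o f] `^ 2)%E.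
  by rewrite -norm2_EFin // poweR_EFin powR_mulrn // norm2_ge0.
rewrite powR_Lnorm // fineK; last first.
  by apply: integrable_fin_num => //; exact: Lfun2_integrable_sqr.
apply: eq_integral => w _.
by rewrite /= powR_mulrn // real_normK // num_real.
Qed.

Lemma normr_int_le_norm2 f : f \in L2 -> `|\int[P]_w f w| <= norm2 f.
Proof.
move=> fL; apply: (le_trans (le_normr_Rintegral _ (L2_integrable fL))) => //.
have := @hoelder _ T R P f (cst 1) 2 2 (L2_measurable fL) (measurable_cst _).
have h2 : 2^-1 + 2^-1 = 1 :> R by rewrite [RHS]splitr div1r.
move=> /(_ _ _ h2) H.
rewrite -lee_fin norm2_EFin //.
apply: (@le_trans _ _ ('N[P]_1%:E[EFin \o (f \* cst 1)%R])%E).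
  rewrite Lnorm1 fineK; last first.
    by have := integrable_fin_num measurableT (integrable_abse (L2_integrable fL)).
  by rewrite le_eqVlt; apply/orP; left; apply/eqP/eq_integral => w _; rewrite /= mulr1.
apply: le_trans (H _ _) _ => //.
have -> : (EFin \o cst 1 : T -> \bar R) = cst 1%E by [].
rewrite Lnorm_cst1 [X in (X `^ _)%E](_ : _ = 1%E) ?poweR1r ?mule1 //.
exact: probability_setT.
Qed.

Lemma L2_bounded f (M : R) : measurable_fun setT f -> (forall w, `|f w| <= M) ->
  f \in L2.
Proof.
move=> mf fM; rewrite inE; apply/andP; split; rewrite inE //=.
rewrite /finite_norm unlock /= poweR_lty //.
apply: (@le_lt_trans _ _ (\int[P]_x (cst ((M `^ 2)%:E) x))%E).
  apply: ge0_le_integral => //.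
  - apply/measurable_EFinP/(measurableT_comp (measurable_powR _)) => //.
    exact: measurableT_comp.
  - move=> w _; rewrite /= lee_fin ge0_ler_powR ?nnegrE //.
    exact: le_trans (fM w).
rewrite integral_cst // [X in (_ * X)%E](_ : _ = 1%E) ?mule1 ?ltry //.
exact: probability_setT.
Qed.

Lemma L2_sqr_lty f : measurable_fun setT f ->
  (\int[P]_w ((f w ^+ 2)%:E) < +oo)%E -> f \in L2.
Proof.
move=> mf fy; rewrite inE; apply/andP; split; rewrite inE //=.
rewrite /finite_norm unlock /= poweR_lty //.
rewrite (_ : (\int[P]_x _)%E = (\int[P]_w ((f w ^+ 2)%:E))%E) //.
apply: eq_integral => w _.
by rewrite /= powR_mulrn // real_normK // num_real.
Qed.

Lemma cvg_L2P X f : (forall n, X n \in L2) -> f \in L2 ->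
  cvg_L2 P X f <-> norm2 (fun w => X n w - f w) @[n --> \oo] --> 0.
Proof.
move=> XL fL; split => [[_ _ H]|H].
  by move/fine_cvg : H.
split => //.
rewrite (_ : (fun n => _) = fun n => (norm2 (fun w => X n w - f w))%:E).
  by apply: cvg_EFin => //; exact: nearW.
by apply/funext => n; rewrite norm2_EFin // L2B.
Qed.

Lemma L2_sum (I : Type) (s : seq I) (F : I -> T -> R) :
  (forall i, F i \in L2) -> (fun w => \sum_(i <- s) F i w) \in L2.
Proof.
move=> FL; elim: s => [|i s IH].
  by under eq_fun do rewrite big_nil; exact: L2_cst.
by under eq_fun do rewrite big_cons; exact: L2D.
Qed.

Lemma int_sum (I : Type) (s : seq I) (F : I -> T -> R) :
  (forall i, F i \in L2) ->
  \int[P]_w (\sum_(i <- s) F i w) = \sum_(i <- s) \int[P]_w F i w.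
Proof.
move=> FL; elim: s => [|i s IH].
  by under eq_Rintegral do rewrite big_nil; rewrite big_nil Rintegral_cst // mul0r.
under eq_Rintegral do rewrite big_cons.
by rewrite RintegralD ?L2_integrable ?L2_sum // IH big_cons.
Qed.

End L2norm.

Section AsL2.
Context {d : measure_display} {T : measurableType d} {R : realType}.
Variable P : probability T R.
Implicit Types (f g V W : T -> R) (X Y : nat -> T -> R).

Local Notation L2 := (Lfun P 2%:E).

(** Both modes of convergence are carried together because linear combinations and the recursion
    respect both. The norm is real-valued so that [rec_le_cvg0] can be applied to it. *)
Definition asL2_cvg X V : Prop :=
  [/\ forall n, X n \in L2, V \in L2,
      {ae P, forall w, X n w @[n --> \oo] --> V w} &
      norm2 P (fun w => X n w - V w) @[n --> \oo] --> 0].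

Lemma eq_asL2_cvg X Y V W : X =2 Y -> V =1 W -> asL2_cvg X V -> asL2_cvg Y W.
Proof.
move=> XY /funext <-; rewrite (_ : Y = X) //.
by apply/funext => n; apply/funext => w; rewrite XY.
Qed.

Lemma asL2_cvg_L2 X V : asL2_cvg X V -> cvg_L2 P X V.
Proof. by case=> XL VL _ XV; apply/cvg_L2P. Qed.

Lemma asL2_cvg_cst V : V \in L2 -> asL2_cvg (fun=> V) V.
Proof.
move=> VL; split => //; first by apply: aeW => w; exact: cvg_cst.
rewrite (_ : (fun n => _) = cst 0); first exact: cvg_cst.
apply/funext => n; under eq_fun do rewrite subrr -[0](mul0r 0).
by rewrite norm2Z ?L2_cst // normr0 mul0r.
Qed.

Lemma asL2_cvgD X Y V W : asL2_cvg X V -> asL2_cvg Y W ->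
  asL2_cvg (fun n w => X n w + Y n w) (fun w => V w + W w).
Proof.
move=> [XL VL Xae X2] [YL WL Yae Y2]; split.
- by move=> n; exact: L2D.
- exact: L2D.
- by apply: filterS2 Xae Yae => w; exact: cvgD.
- apply: (@squeeze_cvgr _ _ _ _ (cst 0) (fun n =>
    norm2 P (fun w => X n w - V w) + norm2 P (fun w => Y n w - W w))).
  + apply: nearW => n; rewrite norm2_ge0 /=.
    under [X in norm2 P X]eq_fun do rewrite opprD addrACA.
    by apply: norm2D; exact: L2B.
  + exact: cvg_cst.
  + by rewrite -(addr0 0); exact: cvgD.
Qed.

Lemma asL2_cvgZ (a : R ^nat) (l : R) X V : a @ \oo --> l -> asL2_cvg X V ->
  asL2_cvg (fun n w => a n * X n w) (fun w => l * V w).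
Proof.
move=> al [XL VL Xae X2]; split.
- by move=> n; exact: L2Z.
- exact: L2Z.
- by apply: filterS Xae => w; exact: cvgM.
- apply: (@squeeze_cvgr _ _ _ _ (cst 0) (fun n =>
    `|a n| * norm2 P (fun w => X n w - V w) + `|a n - l| * norm2 P V)).
  + apply: nearW => n; rewrite norm2_ge0 /=.
    rewrite -!norm2Z ?L2B //.
    apply: le_trans (norm2D _ _); rewrite ?L2Z ?L2B //.
    rewrite le_eqVlt; apply/orP; left; apply/eqP; congr (norm2 P _).
    by apply/funext => w; ring.
  + exact: cvg_cst.
  + rewrite -[X in _ --> X](addr0 0); apply: cvgD.
      by rewrite -(mulr0 `|l|); apply: cvgM => //; exact: cvg_norm.
    rewrite -[X in _ --> X](mul0r (norm2 P V)); apply: cvgM; last exact: cvg_cst.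
    have al0 : (fun n => a n - l) @ \oo --> (0 : R).
      by rewrite -(subrr l); apply: cvgB => //; exact: cvg_cst.
    by move: al0 => /cvg_norm; rewrite normr0.
Qed.

Lemma asL2_cvgZl (l : R) X V : asL2_cvg X V ->
  asL2_cvg (fun n w => l * X n w) (fun w => l * V w).
Proof. by apply: asL2_cvgZ; exact: cvg_cst. Qed.

Lemma asL2_cvg_sum (I : Type) (s : seq I) (Q : pred I) (X : I -> nat -> T -> R)
    (V : I -> T -> R) : (forall i, Q i -> asL2_cvg (X i) (V i)) ->
  asL2_cvg (fun n w => \sum_(i <- s | Q i) X i n w)
    (fun w => \sum_(i <- s | Q i) V i w).
Proof.
move=> XV; elim: s => [|i s IH].
  apply: (@eq_asL2_cvg (fun=> fun=> 0) _ (fun=> 0)) => [n w|w|].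
  - by rewrite big_nil.
  - by rewrite big_nil.
  - exact/asL2_cvg_cst/L2_cst.
have [Qi|Qi] := boolP (Q i).
  by apply: eq_asL2_cvg (asL2_cvgD (XV i Qi) IH) => [n w|w]; rewrite big_cons Qi.
by apply: eq_asL2_cvg IH => [n w|w]; rewrite big_cons (negbTE Qi).
Qed.

Lemma asL2_cvgB X Y V W : asL2_cvg X V -> asL2_cvg Y W ->
  asL2_cvg (fun n w => X n w - Y n w) (fun w => V w - W w).
Proof.
move=> XV /(asL2_cvgZl (-1)) YW.
by apply: eq_asL2_cvg (asL2_cvgD XV YW) => [n w|w]; rewrite mulN1r.
Qed.

Lemma asL2_cvg_int X V : asL2_cvg X V ->
  (fun n => \int[P]_w X n w) @ \oo --> \int[P]_w V w.
Proof.
move=> [XL VL _ X2].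
have H : (fun n => `|\int[P]_w X n w - \int[P]_w V w|) @ \oo --> 0.
  apply: (@squeeze_cvgr _ _ _ _ (cst 0) (fun n => norm2 P (fun w => X n w - V w))) => //.
    apply: nearW => n; rewrite normr_ge0 /=.
    rewrite -RintegralB ?L2_integrable //.
    by apply: normr_int_le_norm2; exact: L2B.
  exact: cvg_cst.
by apply: cvg_zero; apply: norm_cvg0; exact: H.
Qed.

(** Almost surely this is [rec_cvg] on each path. In L2, Minkowski's inequality turns the recursion
    into an inequality between norms, of the form treated by [rec_le_cvg0], with inflow the norm of
    S_n - c_n V / l. *)
Lemma asL2_cvg_rec U S (g c : R ^nat) (l : R) V :
  0 < l -> (forall n, 0 <= g n) -> (forall n, 0 <= 1 - c n * g n) ->
  c @ \oo --> l -> series g @ \oo --> +oo ->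
  (forall n, U n \in L2) -> asL2_cvg S V ->
  (forall n w, U n.+1 w = (1 - c n * g n) * U n w + g n * S n w) ->
  asL2_cvg U (fun w => V w / l).
Proof.
move=> l0 g0 cg0 cl gy UL SV Urec; have [SL VL Sae S2] := SV.
have l_neq0 : l != 0 by rewrite gt_eqF.
have WL : (fun w => V w / l) \in L2.
  by under eq_fun do rewrite mulrC; exact: L2Z.
have cWL n : (fun w => c n * (V w / l)) \in L2 by exact: (L2Z (c n) WL).
have [DL _ _ D0] : asL2_cvg (fun n w => S n w - c n * (V w / l)) (fun w => V w - V w).
  apply: asL2_cvgB => //.
  by apply: eq_asL2_cvg (asL2_cvgZ cl (asL2_cvg_cst WL)) => w //; rewrite mulrC divfK.
split => //.
  apply: filterS Sae => w Sw.
  by apply: (@rec_cvg _ (U ^~ w) g c (S ^~ w) l (V w)).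
apply: (@rec_le_cvg0 _ _ g c (fun n => norm2 P (fun w => S n w - c n * (V w / l))) l) => //.
- by move=> n; exact: norm2_ge0.
- rewrite (_ : (fun n => norm2 P _) =
      fun n => norm2 P (fun w => S n w - c n * (V w / l) - (V w - V w))) //.
  apply/funext => n; congr (norm2 P _).
  by apply/funext => w; rewrite subrr subr0.
- move=> n; rewrite -(ger0_norm (cg0 n)) -[g n in X in _ <= _ + X]ger0_norm //.
  rewrite -!norm2Z ?L2B //.
  apply: le_trans (norm2D _ _); rewrite ?L2Z ?L2B //.
  rewrite le_eqVlt; apply/orP; left; apply/eqP; congr (norm2 P _).
  by apply/funext => w; rewrite Urec; ring.
Qed.

End AsL2.

(** * Martingales of a finite-valued process *)

Section Adapted.
Context {d : measure_display} {T : measurableType d} {R : realType}.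
Variables (P : probability T R) (K : nat) (draw : nat -> T -> 'I_K.+1).
Hypothesis draw_measurable : forall n i, measurable (draw n @^-1` [set i]).
Implicit Types (f g : T -> R) (n m : nat).

Local Notation L2 := (Lfun P 2%:E).

(* A function of the first [n] draws takes finitely many values, so all
   measurability and integrability questions about it are trivial. *)
Definition adapted {U : Type} n (f : T -> U) : Prop :=
  forall w w', (forall i, (i < n)%N -> draw i w = draw i w') -> f w = f w'.

Definition hist n (w : T) : n.-tuple 'I_K.+1 := [tuple draw i w | i < n].

Lemma adapted_factor n f : adapted n f ->
  exists g : n.-tuple 'I_K.+1 -> R, f = g \o hist n.
Proof.
(* The value 0 is for tuples that are the history of no outcome. *)
move=> fa; exists (fun h => if pselect (exists w, hist n w = h) is left e
  then f (proj1_sig (cid e)) else 0).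
apply/funext => w /=; case: pselect => [e|[]]; last by exists w.
case: cid => w' /= h; apply: fa => i ni.
have := congr1 (fun t => tnth t (Ordinal ni)) h.
by rewrite !tnth_mktuple.
Qed.

Lemma adapted_le {U : Type} n m (f : T -> U) : (n <= m)%N -> adapted n f -> adapted m f.
Proof. by move=> nm fa w w' ww'; apply: fa => i ni; apply: ww'; exact: leq_trans nm. Qed.

Lemma past_hist n h : past draw n (hist n @^-1` [set h]).
Proof.
have -> : hist n @^-1` [set h] =
    \bigcap_(i in [set: 'I_n]) (draw i @^-1` [set tnth h i]).
  apply/seteqP; split => w /=.
    by move=> <- i _ /=; rewrite tnth_mktuple.
  move=> H; apply: eq_from_tnth => i; rewrite tnth_mktuple.
  exact: (H i).
apply: (@fin_bigcap_measurable _ (g_sigma_algebraType _)) => //.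
move=> i _; apply: sub_gen_smallest; exists i, (tnth h i); split => //.
Qed.

Lemma measurable_hist n h : measurable (hist n @^-1` [set h]).
Proof.
move: (past_hist h); rewrite /past; apply: smallest_sub.
  exact: sigma_algebra_measurable.
by move=> _ [m [i [_ ->]]]; exact: draw_measurable.
Qed.

Lemma adapted_measurable_preimage n f (B : set R) : adapted n f -> measurable (f @^-1` B).
Proof.
move=> /adapted_factor[g ->].
have -> : (g \o hist n) @^-1` B = \bigcup_(h in g @^-1` B) (hist n @^-1` [set h]).
  apply/seteqP; split => w /=; first by move=> Bw; exists (hist n w).
  by move=> [h Bh /= hE]; rewrite hE.
by apply: fin_bigcup_measurable => // h _; exact: measurable_hist.
Qed.

Lemma adapted_L2 n f : adapted n f -> f \in L2.
Proof.
move=> fa; have [g fE] := adapted_factor fa.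
apply: (@L2_bounded _ _ _ _ _ (\sum_h `|g h|)).
  by move=> _ B _; rewrite setTI; exact: adapted_measurable_preimage fa.
move=> w; rewrite fE /= (bigD1 (hist n w)) //= lerDl.
by apply: sumr_ge0.
Qed.

(** Conditioning by hand: [f] is constant on each of the finitely many atoms of the first [n] draws,
    and the law of the draw is applied to one atom at a time. *)
Lemma int_adapted_draw n f i (q : T -> R) : adapted n f -> adapted n q ->
  (forall A : set T, past draw n A ->
    P (A `&` draw n @^-1` [set i]) = (\int[P]_(w in A) (q w)%:E)%E) ->
  \int[P]_w (f w * (draw n w == i)%:R) = \int[P]_w (f w * q w).
Proof.
move=> fa qa law; have [g fE] := adapted_factor fa.
pose A h := hist n @^-1` [set h].
have fsum w (x : R) : f w * x = \sum_h g h * (\1_(A h) w * x).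
  rewrite fE /= (bigD1 (hist n w)) //= indicE mem_set // mul1r big1 ?addr0 //.
  move=> h hw; rewrite indicE memNset ?mul0r ?mulr0 // /A /= => hE.
  by rewrite hE eqxx in hw.
have indA h : adapted n (\1_(A h) : T -> R).
  move=> w w' ww'; rewrite !indicE; congr (_ : bool)%:R.
  rewrite /A; apply/idP/idP; rewrite !inE /= => <-; apply: eq_from_tnth => j;
  by rewrite !tnth_mktuple ww'.
have sumE (r : T -> R) (ra : adapted n.+1 r) :
    \int[P]_w (f w * r w) = \sum_h g h * \int[P]_w (\1_(A h) w * r w).
  under eq_Rintegral do rewrite fsum.
  have arL h : (fun w => \1_(A h) w * r w) \in L2.
    apply: (@adapted_L2 n.+1) => w w' ww'.
    by rewrite (ra w w') // (adapted_le (leqnSn n) (indA h) ww').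
  rewrite int_sum => [|h]; last exact: L2Z.
  by apply: eq_bigr => h _; rewrite RintegralZl // L2_integrable.
have ia : adapted n.+1 (fun w => (draw n w == i)%:R : R).
  by move=> w w' ww'; rewrite ww'.
rewrite !sumE //; last exact: adapted_le qa.
apply: eq_bigr => h _; congr (_ * _).
have mA : measurable (A h) by exact: measurable_hist.
transitivity (fine (P (A h `&` draw n @^-1` [set i]))).
  rewrite -[in RHS](setIT (_ `&` _)) -(integral_indic P measurableT); last exact: measurableI.
  congr fine; apply: eq_integral => w _; rewrite indicI /= !indicE.
  congr (_ * (nat_of_bool _)%:R)%:E.
  by apply/eqP/idP => [<-|]; rewrite inE.
rewrite law; last exact: past_hist.
rewrite integral_mkcond; congr fine; apply: eq_integral => w _.
rewrite patchE indicE; case: ifPn => _; first by rewrite mul1r.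
by rewrite mul0r.
Qed.

End Adapted.

Section Martingale.
Context {d : measure_display} {T : measurableType d} {R : realType}.
Variables (P : probability T R) (K : nat) (draw : nat -> T -> 'I_K.+1).
Hypothesis draw_measurable : forall n i, measurable (draw n @^-1` [set i]).
Variable D : nat -> T -> R.
Hypothesis D_adapted : forall n, adapted draw n.+1 (D n).
(** The martingale property, expressed as orthogonality to everything determined by the first [n]
    draws. *)
Hypothesis D_centered : forall n (f : T -> R), adapted draw n f ->
  \int[P]_w (f w * D n w) = 0.

Local Notation L2 := (Lfun P 2%:E).
Local Notation var n := (\int[P]_w (D n w ^+ 2)).

Let S n w : R := \sum_(0 <= i < n) D i w.

Let S_S n w : S n.+1 w = S n w + D n w.
Proof. by rewrite /S big_nat_recr. Qed.

Let adL2 n (f : T -> R) : adapted draw n f -> f \in L2.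
Proof. exact: adapted_L2. Qed.

Let adI n (f : T -> R) : adapted draw n f -> P.-integrable setT (EFin \o f).
Proof. by move=> /adL2; exact: L2_integrable. Qed.

Let S_adapted n : adapted draw n (S n).
Proof.
move=> w w' ww'; rewrite /S !big_mkord; apply: eq_bigr => i _.
by apply: D_adapted => j ji; apply: ww'; exact: leq_trans (ltn_ord i).
Qed.

(** The martingale transform by weights known before each step: weights 1 give S n - S m, and
    indicator weights give the stopped martingale. *)
Let transform (m : nat) (H : nat -> T -> R) n w : R :=
  \sum_(m <= i < n) H i w * D i w.

Let transform_adapted m H n : (forall i, adapted draw i (H i)) ->
  adapted draw n (transform m H n).
Proof.
move=> Ha w w' ww'; rewrite /transform !big_nat; apply: eq_bigr => i /andP[_ ni].
rewrite (Ha i w w') => [|j ji]; last by apply: ww'; exact: ltn_trans ni.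
congr (_ * _); apply: D_adapted => j ji; apply: ww'; exact: leq_trans ni.
Qed.

Let var_ge0 n : 0 <= var n.
Proof. by apply: Rintegral_ge0 => w _; exact: sqr_ge0. Qed.

(** Pythagoras: in each new cross term the coefficient [c] of D n is a function of the first [n]
    draws, so the term integrates to 0. *)
Lemma int_transform_sqr m H n : (forall i, adapted draw i (H i)) -> (m <= n)%N ->
  \int[P]_w (transform m H n w ^+ 2) =
  \sum_(m <= i < n) \int[P]_w ((H i w * D i w) ^+ 2).
Proof.
move=> Ha; have ta k : adapted draw k (transform m H k) by exact: transform_adapted.
elim: n => [|n IH] mn.
  move: mn; rewrite leqn0 => /eqP ->.
  rewrite big_geq // /transform.
  under eq_Rintegral do rewrite big_geq // expr0n /=.
  by rewrite Rintegral_cst // mul0r.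
have [mn'|] := leqP m n; last first.
  move=> nm; have -> : m = n.+1 by apply/eqP; rewrite eqn_leq mn.
  rewrite big_geq // /transform.
  under eq_Rintegral do rewrite big_geq // expr0n /=.
  by rewrite Rintegral_cst // mul0r.
rewrite big_nat_recr //= -IH //.
pose c w := 2 * transform m H n w * H n w.
have ca : adapted draw n c by move=> w w' ww'; rewrite /c (ta n w w') // (Ha n w w').
have E w : transform m H n.+1 w ^+ 2 =
    (transform m H n w ^+ 2 + (H n w * D n w) ^+ 2) + c w * D n w.
  by rewrite /transform big_nat_recr //= -/(transform m H n w) /c; ring.
under eq_Rintegral do rewrite E.
have a1 : adapted draw n.+1 (fun w => transform m H n w ^+ 2).
  by move=> w w' ww'; rewrite (adapted_le (leqnSn n) (ta n) ww').
have a2 : adapted draw n.+1 (fun w => (H n w * D n w) ^+ 2).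
  by move=> w w' ww'; rewrite (adapted_le (leqnSn n) (Ha n) ww') // (D_adapted ww').
have a3 : adapted draw n.+1 (fun w => c w * D n w).
  by move=> w w' ww'; rewrite (adapted_le (leqnSn n) ca ww') // (D_adapted ww').
have a12 : adapted draw n.+1 (fun w => transform m H n w ^+ 2 + (H n w * D n w) ^+ 2).
  by move=> w w' ww'; rewrite (a1 w w') // (a2 w w').
rewrite RintegralD ?(adI a12) ?(adI a3) // D_centered // addr0.
by rewrite RintegralD ?(adI a1) ?(adI a2).
Qed.

Lemma int_sub_sqr m n : (m <= n)%N ->
  \int[P]_w ((S n w - S m w) ^+ 2) = \sum_(m <= i < n) var i.
Proof.
move=> mn; have := @int_transform_sqr m (fun _ _ => 1) n (fun _ _ _ _ => erefl) mn.
under [RHS]eq_bigr do under eq_Rintegral do rewrite mul1r.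
move=> <-; apply: eq_Rintegral => w _; congr (_ ^+ 2).
rewrite /S (big_cat_nat (leq0n m) mn) //= addrAC subrr add0r.
by apply: eq_bigr => i _; rewrite mul1r.
Qed.

Let exceed m (e : R) n w : bool :=
  [exists k : 'I_n.+1, (m <= k)%N && (e < `|S k w - S m w|)].

Let exceedP m e n w : reflect
  (exists k, [/\ (m <= k)%N, (k <= n)%N & e < `|S k w - S m w|]) (exceed m e n w).
Proof.
apply: (iffP existsP) => [[k /andP[mk ek]]|[k [mk kn ek]]].
  by exists k; split => //; rewrite -ltnS.
by have kn' : (k < n.+1)%N by []; exists (Ordinal kn'); rewrite mk.
Qed.

Let exceed_adapted m e n : (m <= n)%N -> adapted draw n (exceed m e n).
Proof.
move=> mn w w' ww'; apply: eq_existsb => k.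
have SE j : (j <= n)%N -> S j w = S j w'.
  by move=> jn; apply: S_adapted => i ij; apply: ww'; exact: leq_trans jn.
by rewrite !SE // -ltnS.
Qed.

(* The martingale is stopped the first time it leaves the [e]-ball around [S m];
   the weights [H i] below switch off all later increments. *)
Lemma maximal_inequality m n (e : R) : 0 < e -> (m <= n)%N ->
  (P [set w | exceed m e n w] <= (e ^- 2 * \sum_(m <= i < n) var i)%:E)%E.
Proof.
move=> e0 mn.
pose H i w : R := if (m <= i)%N then (~~ exceed m e i w)%:R else 0.
have Ha i : adapted draw i (H i).
  move=> w w' ww'; rewrite /H; case: leqP => // mi.
  by rewrite (exceed_adapted e mi ww').
(* Until the ball is left, the transform is the martingale itself; afterwards it is frozen at the
   first value outside, hence stays farther than [e] from 0. *)
have key k w : (m <= k)%N ->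
  if exceed m e k w then is_true (e < `|transform m H k w|)
  else transform m H k w = S k w - S m w.
  elim: k => [|k IH] mk.
    move: mk; rewrite leqn0 => /eqP m0; rewrite /transform m0 big_geq // subrr.
    case: exceedP => // -[j [_]]; rewrite leqn0 => /eqP ->.
    by rewrite subrr normr0 ltNge ltW.
  have [mk'|km] := leqP m k; last first.
    have -> : m = k.+1 by apply/eqP; rewrite eqn_leq mk.
    rewrite /transform big_geq // subrr; case: exceedP => // -[j [kj jk]].
    have -> : j = k.+1 by apply/eqP; rewrite eqn_leq jk.
    by rewrite subrr normr0 ltNge ltW.
  have tS : transform m H k.+1 w = transform m H k w + H k w * D k w.
    by rewrite /transform big_nat_recr.
  have exS : exceed m e k w -> exceed m e k.+1 w.
    move=> /exceedP[j [mj jk ej]]; apply/exceedP; exists j; split => //.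
    exact: leqW.
  have Hk : H k w = (~~ exceed m e k w)%:R by rewrite /H mk'.
  move: (IH mk'); rewrite tS Hk.
  have [ek|nek] := boolP (exceed m e k w).
    by rewrite exS //= mul0r addr0.
  move=> ->; rewrite mul1r (_ : _ + _ = S k.+1 w - S m w); last by rewrite S_S; ring.
  case: exceedP => // -[j [mj]]; rewrite leq_eqVlt => /orP[/eqP -> //|jk ej].
  by case/negP: nek; apply/exceedP; exists j.
pose I w : R := (exceed m e n w)%:R.
have Ia : adapted draw n I by move=> w w' ww'; rewrite /I (exceed_adapted e mn ww').
have ta : adapted draw n (transform m H n) by exact: transform_adapted.
have PI : P [set w | exceed m e n w] = (\int[P]_w I w)%:E.
  have mE : measurable [set w | exceed m e n w].
    have -> : [set w | exceed m e n w] = I @^-1` [set 1].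
      apply/seteqP; split => w; rewrite /I /=; first by move=> ->.
      by case: (exceed m e n w) => //= /esym/eqP; rewrite oner_eq0.
    exact: adapted_measurable_preimage Ia.
  rewrite -[in LHS](setIT [set w | _]) -(integral_indic P measurableT) //.
  rewrite fineK; last exact: integrable_fin_num (adI Ia).
  apply: eq_integral => w _; rewrite indicE /I; congr (_ : bool)%:R%:E.
  by apply/idP/idP; rewrite inE.
rewrite PI lee_fin -ler_pdivrMl ?exprn_gt0 ?invr_gt0 // -?exprVn ?invrK; last first.
  by rewrite exprn_gt0 // invr_gt0.
rewrite -RintegralZl ?(adI Ia) //.
apply: (@le_trans _ _ (\int[P]_w (transform m H n w ^+ 2))).
  have a1 : adapted draw n (fun w => e ^+ 2 * I w) by move=> w w' ww'; rewrite (Ia w w').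
  have a2 : adapted draw n (fun w => transform m H n w ^+ 2) by move=> w w' ww'; rewrite (ta w w').
  apply: le_Rintegral => //; [exact: adI a1|exact: adI a2|].
  move=> w _; rewrite /I; have := key n w mn; case: ifP => _.
    move=> /ltW et; rewrite mulr1 -[leRHS]real_normK ?num_real //.
    by rewrite ler_pXn2r ?nnegrE // ltW.
  by rewrite mulr0 sqr_ge0.
rewrite int_transform_sqr //; apply: ler_sum => i _.
have a1 : adapted draw i.+1 (fun w => (H i w * D i w) ^+ 2).
  move=> w w' ww'; rewrite (D_adapted ww') (Ha i w w') // => j ji.
  by apply: ww'; rewrite ltnS ltnW.
have a2 : adapted draw i.+1 (fun w => D i w ^+ 2) by move=> w w' ww'; rewrite (D_adapted ww').
apply: le_Rintegral => //; [exact: adI a1|exact: adI a2|].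
move=> w _; rewrite exprMn ler_piMl ?sqr_ge0 // /H.
case: ifP => _; last by rewrite expr0n.
by case: exceed; rewrite /= ?expr0n ?expr1n.
Qed.

(** The maximal inequality bounds the oscillation after time m by the tail [t m] of the variances,
    which makes almost every path Cauchy; Fatou's lemma then bounds the squared L2 distance to the
    limit by the same tail. *)
Lemma martingale_asL2_cvg (B : R) :
  (forall n, \sum_(0 <= i < n) var i <= B) ->
  exists W : T -> R, asL2_cvg P (fun n w => \sum_(0 <= i < n) D i w) W.
Proof.
move=> varB; pose v i := var i.
have v_nd : nondecreasing_seq (series v) by apply: nondecreasing_series => n _ _; exact: var_ge0.
have vc : cvgn (series v).
  by apply: nondecreasing_is_cvgn => //; exists B => _ [n _ <-]; exact: varB.
pose t m := limn (series v) - series v m.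
have t0 : t @ \oo --> 0.
  rewrite -(subrr (limn (series v))); apply: cvgB; first exact: cvg_cst.
  exact: vc.
have tge m n : (m <= n)%N -> \sum_(m <= i < n) var i <= t m.
  move=> mn; rewrite lerBrDr addrC.
  apply: le_trans (nondecreasing_cvgn_le v_nd vc n).
  by rewrite /series /= (big_cat_nat (leq0n m) mn).
have t_ge0 m : 0 <= t m by have := tge m m (leqnn m); rewrite big_geq.
pose F m e n := [set w | exceed m e n w].
have mF m e n : measurable (F m e n).
  have [mn|nm] := leqP m n; last first.
    rewrite (_ : F _ _ _ = set0) //; apply/seteqP; split => // w /exceedP[k [mk kn _]].
    by have := leq_trans mk kn; rewrite leqNgt nm.
  rewrite (_ : F _ _ _ = (fun w => (exceed m e n w)%:R : R) @^-1` [set 1]).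
    have Fa : adapted draw n (fun w => (exceed m e n w)%:R : R).
      move=> w w' ww'.
      by rewrite (exceed_adapted e mn ww').
    exact: adapted_measurable_preimage Fa.
  apply/seteqP; split => w; rewrite /F /=; first by move=> ->.
  by case: (exceed m e n w) => //= /esym/eqP; rewrite oner_eq0.
have mBad m e : measurable (\bigcup_n F m e n) by exact: bigcupT_measurable.
have PBad m e : 0 < e -> (P (\bigcup_n F m e n) <= (e ^- 2 * t m)%:E)%E.
  move=> e0; have Fc : P \o F m e @ \oo --> P (\bigcup_n F m e n).
    apply: nondecreasing_cvg_mu => //.
    apply/nondecreasing_seqP => n; apply/subsetPset => w /exceedP[k [mk kn ek]].
    by apply/exceedP; exists k; split => //; exact: leqW.
  rewrite -(cvg_lim _ Fc) //; apply: lime_le; first by apply/cvg_ex; eexists; exact: Fc.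
  near=> n; have mn : (m <= n)%N by near: n; exact: nbhs_infty_ge.
  apply: le_trans (maximal_inequality e0 mn) _; rewrite lee_fin.
  by rewrite ler_wpM2l ?invr_ge0 ?exprn_ge0 ?(ltW e0) // tge.
pose e p : R := p.+1%:R^-1.
have e0 p : 0 < e p by rewrite invr_gt0.
(* The paths that are not Cauchy: for some radius 1 / (p + 1) they leave the ball around S m,
   whatever m is. *)
pose N := \bigcup_p \bigcap_m \bigcup_n F m (e p) n.
have N0 : P.-negligible N.
  apply: negligible_bigcup => p; apply/negligibleP.
    by apply: bigcapT_measurable => m.
  apply/eqP; rewrite eq_le measure_ge0 andbT.
  have le1 m : (P (\bigcap_m \bigcup_n F m (e p) n) <= (e p ^- 2 * t m)%:E)%E.
    apply: le_trans (PBad m _ (e0 p)); apply: le_measure.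
    - by rewrite inE; exact: bigcapT_measurable.
    - by rewrite inE.
    - by move=> w /(_ m); exact.
  have lim0 : (fun m => (e p ^- 2 * t m)%:E) @ \oo --> 0%E.
    apply: cvg_EFin; first exact: nearW.
    rewrite -(mulr0 (e p ^- 2)); apply: cvgM => //; exact: cvg_cst.
  rewrite -(cvg_lim _ lim0) //; apply: lime_ge; first by apply/cvg_ex; eexists; exact: lim0.
  exact: nearW.
(* A limsup, so that W is measurable on the whole space, including the null set where the paths may
   fail to converge. *)
pose W w := fine (limn_esup (fun n => (S n w)%:E)).
have Wcvg w : ~ N w -> S n w @[n --> \oo] --> W w.
  move=> Nw; have Sc : cvgn (S ^~ w).
    apply: cauchy_cvg; apply: cauchy_exP => r r0.
    pose p := Num.truncn r^-1.
    have er : e p < r.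
      rewrite /e invf_plt ?posrE //; exact: truncnS_gt.
    have : ~ (\bigcap_m \bigcup_n F m (e p) n) w by move=> H; apply: Nw; exists p.
    move=> /existsNP[m /not_implyP[_ /= Hm]].
    exists (S m w); near=> n; rewrite -ball_normE /= distrC.
    have mn : (m <= n)%N by near: n; exact: nbhs_infty_ge.
    apply: le_lt_trans er; rewrite leNgt; apply/negP => H; apply: Hm.
    by exists n => //; apply/exceedP; exists n.
  have Sc' : (fun n => (S n w)%:E) @ \oo --> (limn (S ^~ w))%:E.
    by apply: cvg_EFin; [exact: nearW|exact: Sc].
  by rewrite /W (cvg_limn_einf_sup Sc').2.
have Wae : {ae P, forall w, S n w @[n --> \oo] --> W w}.
  by apply: negligibleS N0 => w /= /contra_notP; apply => Nw; exact: Wcvg.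
have SL n : S n \in L2 by apply: adL2; exact: S_adapted.
have mW : measurable_fun setT W.
  apply: measurableT_comp => //; apply: measurable_fun_limn_esup => n.
  by apply/measurable_EFinP; exact: L2_measurable.
(* Fatou in k with n fixed: the integrand is almost everywhere the limit of the squares of S n - S
   (n + k). At n = 0, where S vanishes, the bound also shows that W is square integrable. *)
have intW n : (\int[P]_w (((S n w - W w) ^+ 2)%:E) <= (t n)%:E)%E.
  pose f k w : \bar R := ((S n w - S (n + k)%N w) ^+ 2)%:E.
  have mf k : measurable_fun setT (f k).
    apply/measurable_EFinP; apply: measurable_funX.
    by apply: measurable_funB; exact: L2_measurable.
  have f0 k w : (0 <= f k w)%E by rewrite lee_fin sqr_ge0.
  have fae : {ae P, forall w, setT w -> ((S n w - W w) ^+ 2)%:E = limn_einf (f ^~ w)}.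
    apply: filterS Wae => w Sw _.
    suff fw : f k w @[k --> \oo] --> ((S n w - W w) ^+ 2)%:E.
      by rewrite (cvg_limn_einf_sup fw).1.
    apply: cvg_EFin; first exact: nearW.
    apply: (@cvg_comp _ _ _ (fun k => S n w - S (n + k)%N w) (fun x => x ^+ 2) _
      (nbhs (S n w - W w))); last exact: exprn_continuous.
    apply: cvgB; first exact: cvg_cst.
    have := Sw; rewrite -(cvg_shiftn n (S ^~ w)).
    by under eq_fun do rewrite addnC.
  rewrite (ge0_ae_eq_integral measurableT _ _ _ _ fae) //.
  - apply: le_trans (fatou P measurableT mf _) _ => //.
    rewrite limn_einf_lim; apply: lime_le; first exact: is_cvg_einfs.
    apply: nearW => k; apply: (@le_trans _ _ (\int[P]_w f k w)%E).
      by apply: ereal_inf_lbound; exists k => /=.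
    have fE : (\int[P]_w f k w)%E = (\int[P]_w ((S (n + k)%N w - S n w) ^+ 2))%:E.
      rewrite fineK; last first.
        by apply: integrable_fin_num => //; apply: Lfun2_integrable_sqr; exact: L2B.
      by apply: eq_integral => w _; rewrite /f -sqrrN opprB.
    by rewrite fE lee_fin int_sub_sqr ?leq_addr // tge // leq_addr.
  - apply/measurable_EFinP; apply: measurable_funX; apply: measurable_funB => //.
    exact: L2_measurable.
  - apply: measurableT_comp => //; apply: measurable_fun_limn_esup => k.
    exact: measurableT_comp.
  - by move=> w _; rewrite lee_fin sqr_ge0.
  - move=> w _; rewrite limn_einf_lim; apply: lime_ge; first exact: is_cvg_einfs.
    apply: nearW => k; apply: le_ereal_inf_tmp => _ [j /= _ <-]; exact: f0.
have WL : W \in L2.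
  apply: L2_sqr_lty => //; apply: le_lt_trans (ltry (t 0%N)).
  apply: le_trans (intW 0%N); rewrite le_eqVlt; apply/orP; left; apply/eqP.
  by apply: eq_integral => w _; rewrite /S big_geq // sub0r sqrrN.
have SWL n : (fun w => S n w - W w) \in L2 by exact: L2B.
exists W; split => //.
apply: (@squeeze_cvgr _ _ _ _ (cst 0) (fun n => Num.sqrt (t n))).
- apply: nearW => n; rewrite norm2_ge0 /=.
  rewrite -[leLHS]ger0_norm ?norm2_ge0 // -sqrtr_sqr ler_wsqrtr //.
  rewrite (norm2_sqr (SWL n)) -lee_fin fineK; first exact: intW.
  by apply: integrable_fin_num => //; apply: Lfun2_integrable_sqr; exact: SWL.
- exact: cvg_cst.
- rewrite -[X in _ --> X]sqrtr0; apply: (@cvg_comp _ _ _ t Num.sqrt _ _ _ t0).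
  exact: sqrt_continuous.
Unshelve. all: by end_near. Qed.

End Martingale.

(** * Linear functionals of the urn *)

Section UrnNoise.
Context {d : measure_display} {T : measurableType d} {R : realType}.
Variables (P : probability T R) (K : nat) (Rm : 'M[R]_K.+1) (C0 : 'rV[R]_K.+1).
Variables (draw : nat -> T -> 'I_K.+1) (C : nat -> T -> 'rV[R]_K.+1).
Hypothesis Rm_ge0 : forall i j, 0 <= Rm i j.
Hypothesis Rm_row : forall i, \sum_j Rm i j = 1.
Hypothesis C0_gt0 : forall i, 0 < C0 0 i.
Hypothesis urn : urn_process P Rm C0 draw C.
Implicit Types v : 'I_K.+1 -> R.

Local Notation L2 := (Lfun P 2%:E).

Definition wsum v n w : R := \sum_i C n w 0 i * v i.

Definition gain v i : R := \sum_j Rm i j * v j.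

Definition ind_color (k : 'I_K.+1) (i : 'I_K.+1) : R := (i == k)%:R.

Lemma wsum_ind_color k n w : wsum (ind_color k) n w = C n w 0 k.
Proof.
rewrite /wsum (bigD1 k) //= /ind_color eqxx mulr1 big1 ?addr0 // => i /negbTE ->.
by rewrite mulr0.
Qed.

Lemma gain_ind_color k i : gain (ind_color k) i = Rm i k.
Proof.
rewrite /gain (bigD1 k) //= /ind_color eqxx mulr1 big1 ?addr0 // => j /negbTE ->.
by rewrite mulr0.
Qed.

Lemma wsumS v n w : wsum v n.+1 w = wsum v n w + gain v (draw n w).
Proof.
rewrite /wsum /gain -big_split /=; apply: eq_bigr => i _.
by rewrite (urn_step urn) !mxE mulrDl.
Qed.

Lemma counts_ge0 n w i : 0 <= C n w 0 i.
Proof.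
elim: n => [|n IH]; first by rewrite (urn_init urn) ltW.
by rewrite (urn_step urn) !mxE addr_ge0.
Qed.

Lemma counts_adapted n : adapted draw n (C n).
Proof.
elim: n => [|n IH] w w' ww'; first by rewrite !(urn_init urn).
rewrite !(urn_step urn) ww' // (IH w w') // => i ni.
by apply: ww'; exact: leqW.
Qed.

Lemma wsum_adapted v n : adapted draw n (wsum v n).
Proof. by move=> w w' ww'; rewrite /wsum (counts_adapted ww'). Qed.

Lemma wsum_L2 v n : wsum v n \in L2.
Proof. exact: (adapted_L2 _ (urn_draw_measurable urn) (@wsum_adapted v n)). Qed.

(** In conditional terms, the expected value of [v] at the next draw is its average over the urn. It
    follows from [int_adapted_draw] by writing v (draw n) as a combination of the indicators of the
    colors. *)
Lemma int_draw n (f : T -> R) (v : 'I_K.+1 -> R) : adapted draw n f ->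
  \int[P]_w (f w * v (draw n w)) = \int[P]_w (f w * (wsum v n w / n.+1%:R)).
Proof.
move=> fa; have md := urn_draw_measurable urn.
have ad m (g : T -> R) : adapted draw m g -> g \in L2 by exact: adapted_L2.
have La i : (fun w => f w * (draw n w == i)%:R) \in L2.
  apply: (ad n.+1) => w w' ww'.
  by rewrite ww' // (adapted_le (leqnSn n) fa ww').
have Lb i : (fun w => f w * (C n w 0 i / n.+1%:R)) \in L2.
  by apply: (ad n) => w w' ww'; rewrite (counts_adapted ww') (fa w w').
transitivity (\int[P]_w (\sum_i v i * (f w * (draw n w == i)%:R))).
  apply: eq_Rintegral => w _.
  rewrite (bigD1 (draw n w)) //= eqxx mulr1 mulrC big1 ?addr0 // => i.
  by rewrite eq_sym => /negbTE ->; rewrite !mulr0.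
transitivity (\int[P]_w (\sum_i v i * (f w * (C n w 0 i / n.+1%:R)))); last first.
  apply: eq_Rintegral => w _; rewrite /wsum mulr_suml mulr_sumr.
  by apply: eq_bigr => i _; ring.
rewrite !int_sum; try by move=> i; exact: L2Z.
apply: eq_bigr => i _; rewrite !RintegralZl ?L2_integrable //.
congr (_ * _); apply: (int_adapted_draw md) fa _ _.
  by move=> w w' ww'; rewrite (counts_adapted ww').
exact: urn_law urn n i.
Qed.

Definition mean v n : R := \int[P]_w wsum v n w.

Lemma int_gain v n : \int[P]_w gain v (draw n w) = mean (gain v) n / n.+1%:R.
Proof.
have := @int_draw n (fun=> 1) (gain v) (fun _ _ _ => erefl).
under eq_Rintegral do rewrite mul1r.
under [RHS]eq_Rintegral do rewrite mul1r.
by move=> ->; rewrite RintegralZr // L2_integrable // wsum_L2.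
Qed.

Lemma gain_draw_adapted v n : adapted draw n.+1 (fun w => gain v (draw n w)).
Proof. by move=> w w' ww'; rewrite ww'. Qed.

Let gain_draw_L2 v n : (fun w => gain v (draw n w)) \in L2.
Proof. exact: (adapted_L2 _ (urn_draw_measurable urn) (@gain_draw_adapted v n)). Qed.

Lemma meanS v n : mean v n.+1 = mean v n + mean (gain v) n / n.+1%:R.
Proof.
rewrite -int_gain /mean -RintegralD ?L2_integrable ?wsum_L2 //.
by apply: eq_Rintegral => w _; rewrite wsumS.
Qed.

Lemma mean0 v : mean v 0 = \sum_i C0 0 i * v i.
Proof.
rewrite /mean; under eq_Rintegral do rewrite /wsum (urn_init urn).
by rewrite Rintegral_cst // [X in fine X](_ : _ = 1%E) ?mulr1 //; exact: probability_setT.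
Qed.

Lemma mean_gain_ge0 v n : (forall i, 0 <= v i) -> 0 <= mean (gain v) n.
Proof.
move=> v0; apply: Rintegral_ge0 => w _; apply: sumr_ge0 => i _.
by rewrite mulr_ge0 ?counts_ge0 // sumr_ge0 // => j _; rewrite mulr_ge0.
Qed.

Lemma mean_gt0 v n : (forall i, 0 <= v i) -> 0 < mean v 0 -> 0 < mean v n.
Proof.
move=> v0 m0; elim: n => // n IH; rewrite meanS ltr_wpDr // divr_ge0 //.
exact: mean_gain_ge0.
Qed.

Definition draw_noise v (b : R ^nat) n w : R :=
  (gain v (draw n w) - wsum (gain v) n w / n.+1%:R) / b n.+1.

Lemma noise_adapted v b n : adapted draw n.+1 (draw_noise v b n).
Proof.
move=> w w' ww'; rewrite /draw_noise ww' //.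
by rewrite (adapted_le (leqnSn n) (@wsum_adapted (gain v) n) ww').
Qed.

Lemma noise_centered v b n (f : T -> R) : adapted draw n f ->
  \int[P]_w (f w * draw_noise v b n w) = 0.
Proof.
move=> fa; have md := urn_draw_measurable urn.
pose f' w := f w / b n.+1.
have fa' : adapted draw n f' by move=> w w' ww'; rewrite /f' (fa w w').
transitivity (\int[P]_w (f' w * gain v (draw n w) - f' w * (wsum (gain v) n w / n.+1%:R))).
  by apply: eq_Rintegral => w _; rewrite /draw_noise /f'; ring.
have a1 : adapted draw n.+1 (fun w => f' w * gain v (draw n w)).
  by move=> w w' ww'; rewrite ww' // (adapted_le (leqnSn n) fa' ww').
have a2 : adapted draw n (fun w => f' w * (wsum (gain v) n w / n.+1%:R)).
  by move=> w w' ww'; rewrite (fa' w w') // (@wsum_adapted (gain v) _ _ _ ww').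
rewrite RintegralB ?int_draw ?subrr //.
  exact: L2_integrable (adapted_L2 _ md a1).
exact: L2_integrable (adapted_L2 _ md a2).
Qed.

Lemma gain_le v (M : R) : (forall i, v i <= M) -> forall i, gain v i <= M.
Proof.
move=> vM i; rewrite -[M]mul1r -(Rm_row i) mulr_suml.
by apply: ler_sum => j _; rewrite ler_wpM2l.
Qed.

(** The variance of the gain is at most its second moment, which is at most M times its mean because
    the gain lies between 0 and M; that mean is the increase of [mean v]. *)
Lemma noise_var_le v b n (M : R) : (forall i, 0 <= v i <= M) ->
  \int[P]_w (draw_noise v b n w ^+ 2) <= M * (mean v n.+1 - mean v n) / b n.+1 ^+ 2.
Proof.
move=> vM; have md := urn_draw_measurable urn.
have v0 i : 0 <= v i by have /andP[] := vM i.
have vleM i : v i <= M by have /andP[] := vM i.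
pose y w := gain v (draw n w); pose z w := wsum (gain v) n w / n.+1%:R.
have ya : adapted draw n.+1 y by exact: gain_draw_adapted.
have za : adapted draw n z by move=> w w' ww'; rewrite /z (@wsum_adapted (gain v) _ _ _ ww').
have y0 w : 0 <= y w by apply: sumr_ge0 => j _; rewrite mulr_ge0.
have yL : y \in L2 by exact: adapted_L2 ya.
have zL : z \in L2 by exact: adapted_L2 za.
have adI m (f : T -> R) : adapted draw m f -> P.-integrable setT (EFin \o f).
  by move=> fa; apply: L2_integrable; exact: adapted_L2 fa.
have za' : adapted draw n.+1 z := adapted_le (leqnSn n) za.
(* The difference between y^2 and (y - z)^2. Since z is a function of the past, the integral of z y
   is that of z^2, and so the integral of g is nonnegative. *)
pose g w := 2 * (z w * y w) - z w * z w.
have ya2 : adapted draw n.+1 (fun w => y w ^+ 2) by move=> w w' ww'; rewrite (ya w w').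
have zya : adapted draw n.+1 (fun w => z w * y w).
  by move=> w w' ww'; rewrite (ya w w') // (za' w w').
have zya2 : adapted draw n.+1 (fun w => 2 * (z w * y w)).
  by move=> w w' ww'; rewrite (zya w w').
have zza : adapted draw n.+1 (fun w => z w * z w).
  by move=> w w' ww'; rewrite (za' w w').
have ga : adapted draw n.+1 g by move=> w w' ww'; rewrite /g (zya w w') // (za' w w').
have g_ge0 : 0 <= \int[P]_w g w.
  rewrite RintegralB ?(adI _ _ zya2) ?(adI _ _ zza) //.
  rewrite RintegralZl ?(adI _ _ zya) //.
  have -> : \int[P]_w (z w * y w) = \int[P]_w (z w * z w) by exact: int_draw.
  rewrite mulr2n mulrDl mul1r addrK.
  by apply: Rintegral_ge0 => w _; rewrite -expr2 sqr_ge0.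
have yz2 : \int[P]_w ((y w - z w) ^+ 2) <= M * \int[P]_w y w.
  apply: (@le_trans _ _ (\int[P]_w (y w ^+ 2) - \int[P]_w g w)).
    rewrite -RintegralB ?(adI _ _ ya2) ?(adI _ _ ga) //.
    rewrite le_eqVlt; apply/orP; left; apply/eqP; apply: eq_Rintegral => w _.
    by rewrite /g; ring.
  apply: le_trans (_ : \int[P]_w (y w ^+ 2) <= _); first by rewrite gerBl.
  have Mya : adapted draw n.+1 (fun w => M * y w) by move=> w w' ww'; rewrite (ya w w').
  rewrite -RintegralZl ?(adI _ _ ya) //; apply: le_Rintegral => //.
  - exact: adI ya2.
  - exact: adI Mya.
  - by move=> w _; rewrite expr2 ler_wpM2r // gain_le.
have -> : \int[P]_w (draw_noise v b n w ^+ 2) = \int[P]_w ((y w - z w) ^+ 2) / b n.+1 ^+ 2.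
  rewrite -RintegralZr //.
    by apply: eq_Rintegral => w _; rewrite /draw_noise expr_div_n.
  by apply: (adI n.+1) => w w' ww'; rewrite (ya w w') // (za' w w').
rewrite ler_wpM2r ?invr_ge0 ?sqr_ge0 // meanS addrAC subrr add0r.
by rewrite -int_gain.
Qed.

(* Increments of [wsum v] are bounded, so with [m = mean v] the variances are at
   most a constant times (m(n+1) - m(n)) / m(n+1)^2 <= 1/m(n) - 1/m(n+1). *)
Lemma noise_asL2_cvg v (b : R ^nat) (B : R) :
  (forall i, 0 <= v i) -> 0 < mean v 0 -> (forall n, 0 < b n) ->
  (forall n, mean v n <= B * b n) ->
  exists W, asL2_cvg P (fun n w => \sum_(0 <= i < n) draw_noise v b i w) W.
Proof.
move=> v0 m0 b0 mB; pose M := \sum_i v i.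
have vM i : 0 <= v i <= M by rewrite v0 /M (bigD1 i) //= lerDl sumr_ge0.
have M0 : 0 <= M by apply: sumr_ge0.
have mp n : 0 < mean v n by exact: mean_gt0.
have MB0 : 0 <= M * B ^+ 2 by rewrite mulr_ge0 // sqr_ge0.
apply: (@martingale_asL2_cvg _ _ _ _ _ _ (urn_draw_measurable urn) _ _ _
  (M * B ^+ 2 / mean v 0)).
- exact: noise_adapted.
- move=> n f; exact: noise_centered.
move=> n; apply: (@le_trans _ _ (M * B ^+ 2 * ((mean v 0)^-1 - (mean v n)^-1))); last first.
  by rewrite ler_wpM2l // gerBl invr_ge0 ltW.
elim: n => [|n IH]; first by rewrite big_geq // subrr mulr0.
rewrite big_nat_recr //=.
have -> : M * B ^+ 2 * ((mean v 0)^-1 - (mean v n.+1)^-1) =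
  M * B ^+ 2 * ((mean v 0)^-1 - (mean v n)^-1) +
  M * B ^+ 2 * ((mean v n)^-1 - (mean v n.+1)^-1) by ring.
apply: lerD => //; apply: le_trans (noise_var_le b n vM) _.
rewrite -(mulrA M (mean v n.+1 - _)) -(mulrA M (B ^+ 2)) ler_wpM2l //.
have mS : mean v n <= mean v n.+1.
  by rewrite meanS lerDl divr_ge0 // mean_gain_ge0.
have -> : (mean v n)^-1 - (mean v n.+1)^-1 =
    (mean v n.+1 - mean v n) / (mean v n * mean v n.+1).
  by field; rewrite !gt_eqF.
rewrite mulrCA ler_wpM2l ?subr_ge0 //.
rewrite ler_pdivlMr ?mulr_gt0 // mulrC ler_pdivrMr ?exprn_gt0 //.
apply: (@le_trans _ _ (mean v n.+1 ^+ 2)).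
  by rewrite expr2 ler_wpM2r // ltW.
by rewrite -exprMn ler_pXn2r ?nnegrE ?(ltW (mp _)) // (le_trans _ (mB _)) // ltW.
Qed.

End UrnNoise.

(** * Convergence of a single color and of an eigenvector functional *)

Section UrnLimits.
Context {d : measure_display} {T : measurableType d} {R : realType}.
Variables (P : probability T R) (K : nat) (Rm : 'M[R]_K.+1) (C0 : 'rV[R]_K.+1).
Variables (draw : nat -> T -> 'I_K.+1) (C : nat -> T -> 'rV[R]_K.+1).
Hypothesis Rm_ge0 : forall i j, 0 <= Rm i j.
Hypothesis Rm_row : forall i, \sum_j Rm i j = 1.
Hypothesis C0_gt0 : forall i, 0 < C0 0 i.
Hypothesis urn : urn_process P Rm C0 draw C.
Implicit Types (v : 'I_K.+1 -> R) (k : 'I_K.+1).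

Local Notation L2 := (Lfun P 2%:E).
Local Notation wsum := (wsum C).
Local Notation gain := (gain Rm).
Local Notation mean := (mean P C).
Local Notation noise := (draw_noise Rm draw C).

Definition influx k n w : R := \sum_(i | i != k) C n w 0 i * Rm i k.

Lemma wsum_gain_ind_color k n w :
  wsum (gain (ind_color k)) n w = Rm k k * C n w 0 k + influx k n w.
Proof.
rewrite /wsum (bigD1 k) //= gain_ind_color mulrC; congr (_ + _).
by apply: eq_bigr => i _; rewrite gain_ind_color.
Qed.

Lemma influx_L2 k n : influx k n \in L2.
Proof.
have E w : influx k n w = wsum (gain (ind_color k)) n w - Rm k k * wsum (ind_color k) n w.
  by rewrite wsum_gain_ind_color wsum_ind_color addrAC subrr add0r.
rewrite (funext E); apply: L2B; first exact: (wsum_L2 urn).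
by apply: L2Z; exact: (wsum_L2 urn).
Qed.

Lemma mean_ind_color0 k : mean (ind_color k) 0 = C0 0 k.
Proof.
rewrite (mean0 urn) (bigD1 k) //= /ind_color eqxx mulr1 big1 ?addr0 // => i /negbTE ->.
by rewrite mulr0.
Qed.

(* Subtracting [N - W], the martingale of the noise minus its limit, from the
   normalised count leaves a recursion without noise. *)
Lemma urn_step_cvg k (b be g : R ^nat) (c : R) (Z : T -> R) :
  (forall n, 0 < b n) -> (forall n, 0 < be n) -> (forall n, 0 < g n) -> 0 < c ->
  (fun n => (1 - (1 + Rm k k / n.+1%:R) * (b n / b n.+1)) / g n) @ \oo --> c ->
  (fun n => be n / (n.+1%:R * b n.+1) / g n) @ \oo --> (1 : R) ->
  series g @ \oo --> +oo ->
  asL2_cvg P (fun n w => (be n)^-1 * influx k n w) Z ->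
  asL2_cvg P (fun n w => (b n)^-1 * C n w 0 k) (fun w => Z w / c).
Proof.
move=> b0 be0 g0 c0; set rc := (fun n => _ / g n); set th := (fun n => _ / g n).
move=> rcc th1 gy ZZ.
have b_neq0 n : b n != 0 by rewrite gt_eqF.
have be_neq0 n : be n != 0 by rewrite gt_eqF.
have g_neq0 n : g n != 0 by rewrite gt_eqF.
have n1_neq0 n : 1 + n%:R != 0 :> R by rewrite addrC natr1 pnatr_eq0.
pose rh n := (1 + Rm k k / n.+1%:R) * (b n / b n.+1).
have rhE n : 1 - rc n * g n = rh n by rewrite /rc divfK // opprB addrC subrK.
have rh0 n : 0 <= 1 - rc n * g n.
  rewrite rhE mulr_ge0 // ?divr_ge0 ?ltW // ltr_pwDl // divr_ge0 //.
(* The recursion lemmas want the inflow to be multiplied by exactly [g], so the remaining factor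
   [th], which tends to 1, is moved into the inflow. *)
have ZtZ : asL2_cvg P (fun n w => th n * ((be n)^-1 * influx k n w)) Z.
  by apply: eq_asL2_cvg (asL2_cvgZ th1 ZZ) => w //; rewrite mul1r.
have ythE n : th n / be n = (n.+1%:R * b n.+1)^-1 / g n.
  by rewrite /th; field; rewrite ?n1_neq0 ?b_neq0 ?g_neq0 ?be_neq0.
have wL v n : P.-integrable setT (EFin \o wsum v n).
  by apply: L2_integrable; exact: (wsum_L2 urn).
have iL n : P.-integrable setT (EFin \o influx k n).
  by apply: L2_integrable; exact: influx_L2.
have meanE n : mean (gain (ind_color k)) n = Rm k k * mean (ind_color k) n + \int[P]_w influx k n w.
  rewrite -RintegralZl // -RintegralD //; last first.
    by apply: L2_integrable; apply: L2Z; exact: (wsum_L2 urn).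
  by apply: eq_Rintegral => w _; rewrite wsum_gain_ind_color wsum_ind_color.
(* The noise is summable once the mean is at most of order [b]. The normalised mean solves the same
   recursion without noise, hence converges and is bounded. *)
have [B mB] : exists B, forall n, mean (ind_color k) n <= B * b n.
  pose y n := mean (ind_color k) n / b n.
  have yc : y @ \oo --> (\int[P]_w Z w) / c.
    apply: (@rec_cvg _ y g rc (fun n => \int[P]_w (th n * ((be n)^-1 * influx k n w))) c) => //.
    - by move=> n; exact: ltW.
    - exact: asL2_cvg_int ZtZ.
    - move=> n; rewrite rhE.
      under eq_Rintegral do rewrite mulrA ythE.
      rewrite RintegralZl // /y (meanS urn) meanE /rh.
      by field; rewrite ?n1_neq0 ?b_neq0 ?g_neq0.
  have /cvg_seq_bounded[M [_ /(_ (M + 1))]] : cvgn y by apply/cvg_ex; eexists; exact: yc.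
  rewrite ltrDl ltr01 => /(_ isT) yM; exists (M + 1) => n.
  rewrite -ler_pdivrMr //; apply: le_trans (ler_norm _) _; exact: yM.
have [W NW] := noise_asL2_cvg Rm_ge0 Rm_row C0_gt0 urn (v := ind_color k) (b := b) (B := B)
  (fun i => ler0n _ _) (eq_ind_r (fun x => 0 < x) (C0_gt0 k) (mean_ind_color0 k)) b0 mB.
pose N n w := \sum_(0 <= i < n) noise (ind_color k) b i w.
have [NL WL _ _] := NW.
have ND : asL2_cvg P (fun n w => N n w - W w) (fun w => W w - W w).
  by apply: asL2_cvgB NW (asL2_cvg_cst WL).
pose U n w := (b n)^-1 * C n w 0 k - (N n w - W w).
(* Removing N - W from the count before and after a step leaves (1 - rh n) (N - W) to be subtracted,
   that is [g n] times the last term here, which tends to 0 because [rc] converges. *)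
pose S n w := th n * ((be n)^-1 * influx k n w) - rc n * (N n w - W w).
have SZ : asL2_cvg P S Z.
  apply: eq_asL2_cvg (asL2_cvgB ZtZ (asL2_cvgZ rcc ND)) => w //.
  by rewrite subrr mulr0 subr0.
have UL n : U n \in L2.
  apply: L2B; last by case: ND.
  apply: L2Z; have := wsum_L2 urn (ind_color k) n.
  by rewrite (funext (wsum_ind_color C k n)).
have UZ : asL2_cvg P U (fun w => Z w / c).
  apply: (asL2_cvg_rec (g := g) (c := rc) (S := S)) => //; first by move=> n; exact: ltW.
  move=> n w; rewrite rhE /U /S /N big_nat_recr //= -/(N n w).
  rewrite (_ : C n.+1 w 0 k = C n w 0 k + gain (ind_color k) (draw n w)); last first.
    by rewrite -!wsum_ind_color (wsumS urn).
  have e1 : g n * (th n * ((be n)^-1 * influx k n w)) =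
      influx k n w / (n.+1%:R * b n.+1).
    by rewrite /th; field; rewrite ?n1_neq0 ?b_neq0 ?g_neq0 ?be_neq0.
  have e2 : g n * (rc n * (N n w - W w)) = (1 - rh n) * (N n w - W w).
    by rewrite -rhE; ring.
  rewrite [g n * (_ - _)]mulrBr e1 e2 /rh /draw_noise wsum_gain_ind_color.
  by field; rewrite ?n1_neq0 ?b_neq0.
apply: eq_asL2_cvg (asL2_cvgD UZ ND) => [n w|w]; rewrite /U.
  by rewrite subrK.
by rewrite subrr addr0.
Qed.
Section Eigenvector.
Variables (v : 'I_K.+1 -> R) (l : R).
Hypotheses (v_ge0 : forall i, 0 <= v i) (l_ge0 : 0 <= l).
Hypothesis v_eigen : forall i, gain v i = l * v i.
Hypothesis v_gt0 : 0 < \sum_i C0 0 i * v i.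

Let mu := \sum_i C0 0 i * v i.
Let r_gt0 n : 0 < rise l n := rise_gt0 n l_ge0.
Let r_neq0 n : rise l n != 0. Proof. by rewrite gt_eqF. Qed.

Let wsum_gain n w : wsum (gain v) n w = l * wsum v n w.
Proof.
rewrite /wsum mulr_sumr; apply: eq_bigr => i _.
by rewrite v_eigen mulrCA.
Qed.

Let lin_neq0 n : 1 + l / n.+1%:R != 0.
Proof. by rewrite gt_eqF // ltr_pwDl // divr_ge0. Qed.

Lemma eigen_martingale n w :
  (rise l n)^-1 * wsum v n w = mu + \sum_(0 <= i < n) noise v (rise l) i w.
Proof.
elim: n => [|n IH].
  rewrite rise0 invr1 mul1r big_geq // addr0 /wsum.
  by under eq_bigr do rewrite (urn_init urn).
rewrite big_nat_recr //= addrA -IH (wsumS urn) riseS /draw_noise wsum_gain riseS.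
have := r_neq0 n; have := lin_neq0 n.
set a := 1 + _; have -> : l * wsum v n w / n.+1%:R = (a - 1) * wsum v n w.
  by rewrite /a addrAC subrr add0r; ring.
by move=> a0 b0; field; rewrite a0 b0.
Qed.

(** For an eigenvector the mean is exactly mu * rise l n, so the bound on the mean asked for by
    [noise_asL2_cvg] holds with B = mu. *)
Lemma eigen_asL2_cvg :
  exists Y, asL2_cvg P (fun n w => (rise l n)^-1 * wsum v n w) Y.
Proof.
have m0 : mean v 0 = mu by exact: (mean0 urn).
have mE n : mean v n = mu * rise l n.
  elim: n => [|n IH]; first by rewrite m0 rise0 mulr1.
  rewrite (meanS urn) riseS mulrA -IH mulrDr mulr1; congr (_ + _).
  rewrite mulrA; congr (_ / _); rewrite mulrC.
  rewrite -RintegralZl //; last by apply: L2_integrable; exact: (wsum_L2 urn).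
  by apply: eq_Rintegral => w _; rewrite wsum_gain.
have mle n : mean v n <= mu * rise l n by rewrite mE.
have [W NW] := noise_asL2_cvg Rm_ge0 Rm_row C0_gt0 urn (v := v) (b := rise l) (B := mu)
  v_ge0 (eq_ind_r (fun x => 0 < x) v_gt0 m0) r_gt0 mle.
exists (fun w => mu + W w).
apply: eq_asL2_cvg (asL2_cvgD (asL2_cvg_cst (L2_cst P mu)) NW) => // n w.
by rewrite eigen_martingale.
Qed.

(* By orthogonality the limit has at least the variance of the first increment. *)
Lemma eigen_nondegenerate Y i0 : 0 < l -> v i0 = 0 ->
  asL2_cvg P (fun n w => (rise l n)^-1 * wsum v n w) Y ->
  nondegenerate_rv P Y.
Proof.
move=> l0 vi0 UY [c Yc]; have [UL YL _ U2] := UY.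
have m0 : mean v 0 = mu by exact: (mean0 urn).
pose N n w := \sum_(0 <= i < n) noise v (rise l) i w.
have na n : adapted draw n.+1 (noise v (rise l) n) by exact: (noise_adapted urn).
have nc n f : adapted draw n f -> \int[P]_w (f w * noise v (rise l) n w) = 0.
  by move=> fa; exact: (noise_centered urn).
(* The square of the first noise term as a function of the first color drawn, whose law is [C0]. The
   color [i0] alone contributes a positive amount, since v i0 = 0 while l and mu are positive. *)
pose phi i := ((l * v i - l * mu) / rise l 1) ^+ 2.
have var0 : \int[P]_w (noise v (rise l) 0 w ^+ 2) = \sum_i C0 0 i * phi i.
  have := int_draw urn phi (f := fun=> 1) (n := 0) (fun _ _ _ => erefl).
  under eq_Rintegral do rewrite mul1r.
  under [RHS]eq_Rintegral do rewrite mul1r divr1.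
  move=> E; rewrite -(mean0 urn phi) [RHS](_ : _ = \int[P]_w wsum phi 0 w) // -E.
  apply: eq_Rintegral => w _.
  rewrite /phi /draw_noise v_eigen wsum_gain divr1 /wsum.
  by under eq_bigr do rewrite (urn_init urn).
have d0 : 0 < \int[P]_w (noise v (rise l) 0 w ^+ 2).
  rewrite var0 (bigD1 i0) //= ltr_pwDl //.
    rewrite mulr_gt0 // exprn_even_gt0 //= vi0 mulr0 sub0r.
    by rewrite mulf_neq0 ?invr_neq0 // oppr_eq0 mulf_neq0 // gt_eqF.
  by apply: sumr_ge0 => i _; rewrite mulr_ge0 ?sqr_ge0 // ltW.
have varN n : \int[P]_w (noise v (rise l) 0 w ^+ 2) <= \int[P]_w (N n.+1 w ^+ 2).
  have := int_sub_sqr (urn_draw_measurable urn) na nc (leq0n n.+1).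
  under eq_Rintegral do rewrite [X in _ - X]big_geq // subr0.
  move=> ->; rewrite big_nat_recl //= lerDl sumr_ge0 // => i _.
  by apply: Rintegral_ge0 => w _; exact: sqr_ge0.
have NE n w : N n w = (rise l n)^-1 * wsum v n w - mu.
  by rewrite eigen_martingale addrAC subrr add0r.
have NL n : N n \in L2.
  by rewrite (funext (NE n)); apply: L2B => //; exact: L2_cst.
have intN n : \int[P]_w N n w = 0.
  have nL i : noise v (rise l) i \in L2 by exact: (adapted_L2 P (urn_draw_measurable urn) (na i)).
  rewrite int_sum => [|i]; last exact: nL.
  rewrite big1 // => i _; have := nc i (fun=> 1) (fun _ _ _ => erefl).
  by under eq_Rintegral do rewrite mul1r.
pose Q n := norm2 P (fun w => (rise l n)^-1 * wsum v n w - Y w).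
(* If Y were the constant c, the squared L2 error would split into the variance of N n and a
   constant; for n > 0 the former is at least the variance of the first term, so the error could not
   vanish. *)
have QE n : Q n ^+ 2 = \int[P]_w (N n w ^+ 2) + (mu - c) ^+ 2.
  rewrite norm2_sqr ?L2B //.
  transitivity (\int[P]_w (N n w ^+ 2 + (2 * (mu - c) * N n w + (mu - c) ^+ 2))).
    congr fine; apply: ae_eq_integral => //.
    - by apply/measurable_EFinP/measurable_funX/L2_measurable/L2B.
    - apply/measurable_EFinP/measurable_funD.
        exact/measurable_funX/L2_measurable.
      by apply/L2_measurable/L2D; [exact: L2Z|exact: L2_cst].
    - apply: filterS Yc => w -> _; congr EFin; rewrite NE; ring.
  have I1 : P.-integrable setT (EFin \o (fun w => N n w ^+ 2)) by exact: Lfun2_integrable_sqr.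
  have I2 : P.-integrable setT (EFin \o (fun w => 2 * (mu - c) * N n w)).
    by apply: L2_integrable; exact: L2Z.
  have I3 : P.-integrable setT (EFin \o (fun _ : T => (mu - c) ^+ 2)).
    by apply: L2_integrable; exact: L2_cst.
  have I4 : P.-integrable setT (EFin \o (fun w => 2 * (mu - c) * N n w + (mu - c) ^+ 2)).
    by apply: L2_integrable; apply: L2D; [exact: L2Z|exact: L2_cst].
  rewrite RintegralD // RintegralD // RintegralZl ?L2_integrable // intN mulr0 add0r.
  congr (_ + _); rewrite Rintegral_cst // [X in fine X](_ : _ = 1%E) ?mulr1 //.
  exact: probability_setT.
have Q0 : (fun n => Q n.+1 ^+ 2) @ \oo --> (0 : R).
  have QQ : (fun n => Q n * Q n) @ \oo --> (0 * 0 : R) by exact: cvgM.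
  by rewrite (cvg_shiftS (fun n => Q n ^+ 2)); rewrite mulr0 in QQ.
have : \int[P]_w (noise v (rise l) 0 w ^+ 2) <= 0.
  rewrite -(cvg_lim _ Q0) //; apply: limr_ge; first by apply/cvg_ex; eexists; exact: Q0.
  apply: nearW => n; rewrite QE; apply: le_trans (varN n) _.
  by rewrite lerDl sqr_ge0.
by rewrite leNgt d0.
Qed.

End Eigenvector.

End UrnLimits.

(** * Blocks *)

(* Back substitution, one row at a time upwards from row [k]. *)
Lemma upper_eigenvector {R : realType} (K : nat) (Rm : 'M[R]_K.+1) (k : 'I_K.+1) :
  upper_triangular Rm -> (forall i j, 0 <= Rm i j) ->
  (forall m : 'I_K.+1, (m < k)%N -> Rm m m < Rm k k) ->
  exists v : 'I_K.+1 -> R, [/\ forall i, 0 <= v i, v k = 1,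
    forall m : 'I_K.+1, (k < m)%N -> v m = 0 &
    forall i, gain Rm v i = Rm k k * v i].
Proof.
move=> utR Rm0 ltk; set l := Rm k k.
(* [s] counts the rows above [k] already solved. The rows after [k] satisfy the equation from the
   start, both sides being 0 by triangularity. *)
suff H s : exists v : 'I_K.+1 -> R, [/\ forall i, 0 <= v i, v k = 1,
    forall m : 'I_K.+1, (k < m)%N -> v m = 0 &
    forall i : 'I_K.+1, (k <= i + s)%N -> gain Rm v i = l * v i].
  have [v [v0 vk vm ve]] := H k; exists v; split => // i.
  by apply: ve; exact: leq_addl.
elim: s => [|s [v [v0 vk vm ve]]].
  exists (ind_color k); split.
  - by move=> i; exact: ler0n.
  - by rewrite /ind_color eqxx.
  - by move=> m km; rewrite /ind_color -val_eqE /= gtn_eqF.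
  - move=> i; rewrite addn0 leq_eqVlt gain_ind_color => /orP[/eqP/val_inj <-|ki].
      by rewrite /ind_color eqxx mulr1.
    by rewrite utR // /ind_color -val_eqE /= gtn_eqF // mulr0.
have [ks|sk] := leqP k s.
  by exists v; split => // i _; apply: ve; exact: leq_trans (leq_addl _ _).
have i0K : (k - s.+1 < K.+1)%N by rewrite (leq_ltn_trans (leq_subr _ _)).
pose i0 := Ordinal i0K.
have i0k : (i0 < k)%N by rewrite /= ltn_subrL /=; case: (nat_of_ord k) sk.
(* The solution of the equation of row [i0]; the strict maximality of l makes the denominator
   positive and x nonnegative. *)
pose x := (\sum_(j | j != i0) Rm i0 j * v j) / (l - Rm i0 i0).
have l0 : 0 < l - Rm i0 i0 by rewrite subr_gt0 ltk.
have x0 : 0 <= x.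
  by rewrite divr_ge0 ?(ltW l0) // sumr_ge0 // => j _; rewrite mulr_ge0.
pose v' j := if j == i0 then x else v j.
have gainE i : gain Rm v' i = Rm i i0 * x + \sum_(j | j != i0) Rm i j * v j.
  rewrite /gain (bigD1 i0) //= /v' eqxx; congr (_ + _).
  by apply: eq_bigr => j /negbTE ->.
exists v'; split.
- by move=> i; rewrite /v'; case: eqP.
- by rewrite /v' -val_eqE /= gtn_eqF.
- by move=> m km; rewrite /v' -val_eqE /= gtn_eqF ?vm // (ltn_trans i0k).
- move=> i ki; rewrite gainE /v'; have [->|ii0] := eqVneq i i0.
    rewrite -[X in _ + X](@divfK _ (l - Rm i0 i0)) ?gt_eqF // -/x; ring.
  have i0i : (i0 < i)%N.
    have : (k - s.+1 <= i)%N by lia.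
    rewrite leq_eqVlt => /orP[/eqP E|//].
    by case/eqP: ii0; apply: val_inj; rewrite /= E.
  (* Rows below [i0] have a zero in column [i0], so changing that coordinate leaves their equations
     intact. *)
  rewrite (utR i i0) // mul0r add0r -ve; last by move: i0i => /=; lia.
  by rewrite /gain [RHS](bigD1 i0) //= (utR i i0) // mul0r add0r.
Qed.

Section Blocks.
Context {R : realType} {K : nat} (Rm : 'M[R]_K.+1).
Context {J : nat} (lead : 'I_J.+1 -> 'I_K.+1).
Hypothesis utR : upper_triangular Rm.
Hypothesis Rm_ge0 : forall i j, 0 <= Rm i j.
Hypothesis Rm_row : forall i, \sum_j Rm i j = 1.
Hypothesis leadP : running_maxima Rm lead.
Implicit Types j : 'I_J.+1.

Local Notation lam := (lambda Rm lead).
Local Notation nuj := (nu Rm lead).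

Lemma prev_blockK j : (0 < j)%N ->
  (prev_block j < J)%N /\ next_block (prev_block j) = j.
Proof.
move=> j0; have jJ := ltn_ord j.
have pE : prev_block j = j.-1 :> nat by rewrite /prev_block inordK //; lia.
split; first by rewrite pE; lia.
by apply: val_inj; rewrite /next_block pE prednK //= inordK.
Qed.

Lemma lead_prev j : (0 < j)%N ->
  [/\ (lead (prev_block j) < lead j)%N, lam (prev_block j) <= lam j &
      forall k : 'I_K.+1, (lead (prev_block j) < k < lead j)%N ->
        diag Rm k < lam (prev_block j)].
Proof.
move=> /prev_blockK[pJ pE]; have [_ _ /(_ _ pJ)] := leadP.
by rewrite pE.
Qed.

Lemma block_ind (Q : 'I_J.+1 -> Prop) : Q ord0 ->
  (forall j, (0 < j)%N -> Q (prev_block j) -> Q j) -> forall j, Q j.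
Proof.
move=> Q0 QS j; have [n] := ubnP (nat_of_ord j); elim: n j => // n IH j jn.
have [j0|j0] := posnP j; first by rewrite (_ : j = ord0) //; exact: val_inj.
apply: QS => //; apply: IH.
by rewrite /prev_block inordK; have := ltn_ord j; lia.
Qed.

Lemma diag_le_lambda j (m : 'I_K.+1) : (m <= lead j)%N -> diag Rm m <= lam j.
Proof.
have [lead0 _ _] := leadP.
elim/block_ind: j m => [|j j0 IH] m.
  rewrite lead0 leqn0 => /eqP m0; rewrite /lambda lead0.
  by rewrite (_ : m = ord0) //; exact: val_inj.
have [pj lej ltj] := lead_prev j0; rewrite leq_eqVlt => /orP[/eqP/val_inj ->//|mj].
have [mp|pm] := leqP m (lead (prev_block j)); first exact: le_trans (IH _ mp) lej.
by apply: le_trans lej; apply/ltW/ltj; rewrite pm.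
Qed.

Lemma diag_lt_lead j (m : 'I_K.+1) : (0 < j)%N -> (m < lead j)%N ->
  diag Rm m <= lam (prev_block j).
Proof.
move=> j0 mj; have [pj lej ltj] := lead_prev j0.
have [mp|pm] := leqP m (lead (prev_block j)); first exact: diag_le_lambda.
by apply/ltW/ltj; rewrite pm.
Qed.

Lemma nu_ord0 : nuj ord0 = 0%N.
Proof.
have [lead0 _ _] := leadP; rewrite /nu lead0.
by apply: eq_card0 => m; rewrite !inE ltn0.
Qed.

Lemma nu_lt j : (0 < j)%N -> lam (prev_block j) < lam j -> nuj j = 0%N.
Proof.
move=> j0 ltj; apply: eq_card0 => m; rewrite !inE.
apply/negbTE/negP => /andP[mj /eqP mE].
by have := diag_lt_lead j0 mj; rewrite mE leNgt ltj.
Qed.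

(** The one additional color is the previous leading color: the colors strictly between the two
    leading ones have smaller diagonal entries. *)
Lemma nu_eq j : (0 < j)%N -> lam (prev_block j) = lam j ->
  nuj j = (nuj (prev_block j)).+1.
Proof.
move=> j0 eqj; have [pj lej ltj] := lead_prev j0.
rewrite /nu (cardD1 (lead (prev_block j))) !inE pj -eqj eqxx add1n; congr _.+1.
apply: eq_card => m; rewrite !inE.
have [->|mp] := eqVneq m (lead (prev_block j)); first by rewrite ltnn.
rewrite /=; apply/andP/andP => -[mj mE]; split => //; last exact: ltn_trans pj.
rewrite ltnNge; apply/negP => pm; have := ltj m; rewrite (eqP mE) ltxx mj andbT.
by move=> /(_ _)/negP; rewrite ltn_neqAle pm andbT eq_sym; apply.
Qed.

Lemma nu_gt0 j : (0 < nuj j)%N ->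
  [/\ (0 < j)%N, lam (prev_block j) = lam j & nuj j = (nuj (prev_block j)).+1].
Proof.
move=> nj; have j0 : (0 < j)%N.
  rewrite lt0n; apply: contraTneq nj => j0.
  by rewrite (_ : j = ord0) ?nu_ord0 //; exact: val_inj.
have [_ lej _] := lead_prev j0.
move: lej; rewrite le_eqVlt => /orP[/eqP E|ltj]; last by rewrite nu_lt in nj.
by split => //; exact: nu_eq.
Qed.

Lemma nu0_diag_lt j (m : 'I_K.+1) : nuj j = 0%N -> (m < lead j)%N -> Rm m m < Rm (lead j) (lead j).
Proof.
move=> nj mj; rewrite lt_neqAle; have -> /= := diag_le_lambda (ltnW mj).
rewrite andbT; apply/negP => /eqP E.
by have := card0_eq nj m; rewrite !inE mj /= /diag E eqxx.
Qed.

Lemma lambda_ge0 j : 0 <= lam j. Proof. exact: Rm_ge0. Qed.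

Lemma entry_le1 i k : Rm i k <= 1.
Proof. by rewrite -(Rm_row i) (bigD1 k) //= lerDl sumr_ge0. Qed.

Lemma lambda_le1 j : lam j <= 1. Proof. exact: entry_le1. Qed.

Lemma lambda_last : lam ord_max = 1.
Proof.
have [_ leadJ _] := leadP; rewrite /lambda /diag leadJ -(Rm_row ord_max).
rewrite (bigD1 ord_max) //= big1 ?addr0 // => k kK; apply: utR.
by have := ltn_ord k; move: kK; rewrite -val_eqE /=; lia.
Qed.

(** If lambda_j were 1, the row sum would leave nothing off the diagonal in the row of the leading
    color, so the very next color would receive nothing from it. This contradicts the increasing
    order if that color is inside the block, and the tie condition if it leads the next block. *)
Lemma lambda_lt1 j : increasing_order Rm lead -> linked_ties Rm lead ->
  (j < J)%N -> lam j < 1.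
Proof.
move=> incr ties jJ; rewrite lt_neqAle lambda_le1 andbT; apply/negP => /eqP l1.
have [_ _ /(_ _ jJ)[ln lel ltl]] := leadP.
have l1' : Rm (lead j) (lead j) = 1 by exact: l1.
have row0 k : k != lead j -> Rm (lead j) k = 0.
  move=> kj; have := Rm_row (lead j); rewrite (bigD1 (lead j)) //= l1'.
  move=> /(canRL (addKr _)); rewrite addNr => /eqP; rewrite psumr_eq0 // => /allP /(_ k).
  by rewrite mem_index_enum kj => /(_ isT)/eqP.
have kK : ((lead j).+1 < K.+1)%N by apply: leq_ltn_trans ln (ltn_ord _).
pose k := Ordinal kK.
have sum0 : \sum_(m < K.+1 | (lead j <= m < k)%N) Rm m k = 0.
  apply: big1 => m; rewrite /= ltnS -eqn_leq => /eqP/val_inj <-.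
  by apply: row0; rewrite -val_eqE /= gtn_eqF.
have [kE|kn] := eqVneq (lead (next_block j)) k.
  have tie : diag Rm (lead j) = diag Rm (lead (next_block j)).
    apply/eqP; rewrite eq_le lel /=.
    by apply: le_trans (entry_le1 _ _) _; rewrite -/(lam j) l1.
  by have := ties j jJ tie; rewrite kE sum0 ltxx.
have jkn : (lead j < k < lead (next_block j))%N.
  by rewrite /= leqnn /=; move: kn ln; rewrite -val_eqE /=; lia.
by have := incr j k jJ jkn; rewrite sum0 ltxx.
Qed.

Lemma color_ofE j (a : 'I_(block_pred lead j).+1) :
  color_of a = (lead j + a)%N :> nat /\ (color_of a < block_end lead j)%N.
Proof.
have [_ leadJ ldP] := leadP.
have := ltn_ord a; rewrite /block_pred /color_of /block_end.
move: (nat_of_ord a) => m; have := ltn_ord (lead j).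
case: ifPn => jJ; last by move=> ? ?; rewrite inordK; lia.
have [+ _ _] := ldP j jJ; have := ltn_ord (lead (next_block j)).
by move=> *; rewrite inordK; lia.
Qed.

Lemma color_of_onto j (k : 'I_K.+1) : (lead j <= k < block_end lead j)%N ->
  exists a : 'I_(block_pred lead j).+1, color_of a = k.
Proof.
move=> /andP[jk ke].
have ak : (k - lead j < (block_pred lead j).+1)%N by rewrite /block_pred; lia.
exists (Ordinal ak); apply: val_inj.
have [aE _] := color_ofE (Ordinal ak); move: aE => /= ->; exact: subnKC.
Qed.

Lemma block_sum j (F : 'I_K.+1 -> R) :
  \sum_(k : 'I_K.+1 | (lead j <= k < block_end lead j)%N) F k =
  \sum_(a < (block_pred lead j).+1) F (color_of a).
Proof.
rewrite (reindex_onto (@color_of K J lead j)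
  (fun k : 'I_K.+1 => inord (k - lead j)%N)) /=.
  apply: eq_bigl => a; have [aE ae] := color_ofE a.
  rewrite ae aE leq_addr /=; apply/eqP/val_inj => /=.
  by rewrite addnC addnK inord_val.
move=> k /[dup] /color_of_onto[a <-] _.
have [aE _] := color_ofE a.
by congr color_of; rewrite aE addnC addnK inord_val.
Qed.

Lemma block_end_prev j : (0 < j)%N -> block_end lead (prev_block j) = lead j.
Proof. by move=> /prev_blockK[pJ pE]; rewrite /block_end pJ pE. Qed.

Lemma color_of0 j : color_of (ord0 : 'I_(block_pred lead j).+1) = lead j.
Proof.
have [aE _] := color_ofE (ord0 : 'I_(block_pred lead j).+1).
by apply: val_inj; move: aE => /= ->; exact: addn0.
Qed.

Lemma diag_color_lt j (a : 'I_(block_pred lead j).+1) :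
  a != ord0 -> diag Rm (color_of a) < lam j.
Proof.
move=> a0; have [aE ae] := color_ofE a.
have a_gt0 : (0 < a)%N by rewrite lt0n.
have [_ leadJ ldP] := leadP.
have [jJ|Jj] := ltnP j J.
  have [_ _] := ldP j jJ; apply; rewrite aE; move: ae; rewrite /block_end jJ aE; lia.
have jE : j = ord_max by apply: val_inj => /=; have := ltn_ord j; lia.
have ljE : lead j = K :> nat by rewrite jE leadJ.
by have := ltn_ord (color_of a); move: aE ae a_gt0; rewrite ljE; lia.
Qed.

(** One coordinate of the eigenvector equation with the diagonal term moved to the right. It is the
    balance s = c u in the limit of the recursion for a color inside the block. *)
Lemma pi_eigen j (a : 'I_(block_pred lead j).+1) :
  \sum_(i < (block_pred lead j).+1 | (i < a)%N)
    block_pi Rm lead j 0 i * Rm (color_of i) (color_of a) =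
  (lam j - diag Rm (color_of a)) * block_pi Rm lead j 0 a.
Proof.
have [piE _] := is_pi_block_pi utR leadP j.
have := congr1 (fun M : 'rV_ _ => M 0 a) piE; rewrite mxE [RHS]mxE.
under eq_bigr do rewrite mxE.
rewrite (bigID (fun i : 'I__ => (i < a)%N)) /= [X in _ + X](bigD1 a) ?ltnn //=.
rewrite [X in _ + (_ + X)]big1 ?addr0.
  by move=> E; rewrite mulrBl -E /diag; ring.
move=> i /andP[ia ina]; rewrite [Rm _ _]utR ?mulr0 //.
have [-> _] := color_ofE i; have [-> _] := color_ofE a.
by rewrite ltn_add2l ltn_neqAle eq_sym val_eqE ina leqNgt.
Qed.

End Blocks.

(** * Limits along the blocks *)

Section Assembly.
Context {d : measure_display} {T : measurableType d} {R : realType}.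
Variables (P : probability T R) (K : nat) (Rm : 'M[R]_K.+1) (C0 : 'rV[R]_K.+1).
Variables (J : nat) (lead : 'I_J.+1 -> 'I_K.+1).
Variables (draw : nat -> T -> 'I_K.+1) (C : nat -> T -> 'rV[R]_K.+1).
Hypothesis utR : upper_triangular Rm.
Hypothesis Rm_ge0 : forall i j, 0 <= Rm i j.
Hypothesis Rm_row : forall i, \sum_j Rm i j = 1.
Hypothesis C0_gt0 : forall i, 0 < C0 0 i.
Hypothesis leadP : running_maxima Rm lead.
Hypothesis urn : urn_process P Rm C0 draw C.
Implicit Types (j : 'I_J.+1) (Y : T -> R).

Local Notation lam := (lambda Rm lead).
Local Notation nuj := (nu Rm lead).
Local Notation pi_ := (block_pi Rm lead).
Local Notation sc j := (scale (lam j) (nuj j)).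

(** No limit is asked of a color that does not feed [k]: the larger colors may grow faster than
    [be]. *)
Lemma influx_asL2_cvg k (be : R ^nat) (L : 'I_K.+1 -> T -> R) :
  (forall i, i != k -> Rm i k = 0 \/
    asL2_cvg P (fun n w => (be n)^-1 * C n w 0 i) (L i)) ->
  asL2_cvg P (fun n w => (be n)^-1 * influx Rm C k n w)
    (fun w => \sum_(i | i != k) Rm i k * L i w).
Proof.
move=> H; pose X i n w := Rm i k * ((be n)^-1 * C n w 0 i).
apply: (@eq_asL2_cvg _ _ _ _ (fun n w => \sum_(i | i != k) X i n w) _
  (fun w => \sum_(i | i != k) Rm i k * L i w)) => //.
  move=> n w; rewrite /influx mulr_sumr; apply: eq_bigr => i _.
  by rewrite /X; ring.
apply: asL2_cvg_sum => i ik; have [R0|Li] := H i ik; last exact: asL2_cvgZl.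
apply: eq_asL2_cvg (asL2_cvg_cst (L2_cst P 0)) => [n w|w].
  by rewrite /X R0 mul0r.
by rewrite R0 mul0r.
Qed.

(* Meaningless beyond the end of the block, where it only ever gets multiplied
   by entries below the diagonal. *)
Definition block_coef j (i : 'I_K.+1) : R :=
  if (lead j <= i)%N then pi_ j 0 (inord (i - lead j)) else 0.

Lemma block_coef_color j a : block_coef j (color_of a) = pi_ j 0 a.
Proof.
have [aE _] := color_ofE leadP a.
by rewrite /block_coef aE leq_addr addnC addnK inord_val.
Qed.

Lemma sum_block_coef j (k : 'I_K.+1) : (k <= block_end lead j)%N ->
  \sum_(i | i != k) Rm i k * block_coef j i =
  \sum_(a < (block_pred lead j).+1 | (color_of a < k)%N) pi_ j 0 a * Rm (color_of a) k.
Proof.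
move=> ke; pose F (i : 'I_K.+1) := if (i < k)%N then Rm i k * block_coef j i else 0.
transitivity (\sum_(i : 'I_K.+1 | (lead j <= i < block_end lead j)%N) F i).
  rewrite big_mkcond [RHS]big_mkcond /=; apply: eq_bigr => i _; rewrite /F.
  have [ik|ki|/val_inj->] := ltngtP i k.
  - rewrite -val_eqE /= ltn_eqF // (leq_trans ik ke) andbT /block_coef.
    by case: ifP => // _; rewrite mulr0.
  - by rewrite -val_eqE /= gtn_eqF // utR // mul0r if_same.
  - by rewrite eqxx /= if_same.
rewrite (block_sum leadP) [RHS]big_mkcond /=; apply: eq_bigr => a _; rewrite /F.
by case: ifP => // _; rewrite block_coef_color mulrC.
Qed.

Definition below_negligible j : Prop := forall k : 'I_K.+1, (k < lead j)%N ->
  asL2_cvg P (fun n w => (sc j n)^-1 * C n w 0 k) (fun=> 0).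

Definition block_cvg j Y : Prop :=
  forall a : 'I_(block_pred lead j).+1,
    asL2_cvg P (fun n w => (sc j n)^-1 * C n w 0 (color_of a))
      (fun w => pi_ j 0 a * Y w).

Let sc_gt0 j n : 0 < sc j n.
Proof. by apply: scale_gt0; exact: lambda_ge0. Qed.

(** Induction on the position in the block. By triangularity a color is fed only by smaller ones:
    those of the block, whose limits are known, and those before it, which are negligible on this
    scale. *)
Lemma block_cvg_of_lead j Y : below_negligible j ->
  asL2_cvg P (fun n w => (sc j n)^-1 * C n w 0 (lead j)) Y -> block_cvg j Y.
Proof.
move=> zj lY a; have [m] := ubnP (nat_of_ord a); elim: m a => // m IH a am.
have [->|a0] := eqVneq a ord0.
  rewrite (color_of0 leadP); apply: eq_asL2_cvg lY => // w.
  by have [_ ->] := is_pi_block_pi utR leadP j; rewrite mul1r.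
have [aE ae] := color_ofE leadP a.
have lr : 0 < lam j - diag Rm (color_of a).
  by rewrite subr_gt0 (diag_color_lt leadP).
have [h1 h2] := scale_step_same (diag Rm (color_of a)) (nuj j) (lambda_ge0 lead Rm_ge0 j).
pose Z w := \sum_(i | i != color_of a) Rm i (color_of a) * (block_coef j i * Y w).
have ZE w : Z w = (lam j - diag Rm (color_of a)) * pi_ j 0 a * Y w.
  rewrite /Z; under eq_bigr do rewrite mulrA.
  rewrite -mulr_suml sum_block_coef ?(ltnW ae) // -(pi_eigen utR leadP).
  congr (_ * _); apply: eq_bigl => i.
  by have [-> _] := color_ofE leadP i; rewrite aE ltn_add2l.
have g0 (n : nat) : 0 < n.+1%:R^-1 :> R by rewrite invr_gt0.
have H := urn_step_cvg Rm_ge0 Rm_row C0_gt0 urn (k := color_of a) (Z := Z)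
  (sc_gt0 j) (sc_gt0 j) g0 lr h1 h2 cvg_series_harmonic.
apply: eq_asL2_cvg (H _) => // [w|].
  by rewrite ZE; field; rewrite gt_eqF.
apply: influx_asL2_cvg => i ik.
have [ia|ai] := ltnP i (color_of a); last first.
  by left; apply: utR; rewrite ltn_neqAle ai eq_sym ik.
right; have [ij|ji] := ltnP i (lead j).
  apply: eq_asL2_cvg (zj i ij) => // w.
  by rewrite /block_coef leqNgt ij /= mul0r.
have [|b bE] := @color_of_onto _ _ Rm _ lead leadP j i; first by rewrite ji (ltn_trans ia).
rewrite -bE; apply: eq_asL2_cvg (IH b _) => // [w|].
  by rewrite block_coef_color.
have [bE' _] := color_ofE leadP b.
by move: ia am; rewrite -bE bE' aE; lia.
Qed.

(** Every color before block j has a limit on the previous scale, and the next scale is larger by a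
    power of n or, in a tie, by one logarithm. *)
Lemma below_negligible_next j Y : (0 < j)%N -> below_negligible (prev_block j) ->
  block_cvg (prev_block j) Y -> below_negligible j.
Proof.
move=> j0 zp bp k kj; pose p := prev_block j.
have [L HL] : exists L, asL2_cvg P (fun n w => (sc p n)^-1 * C n w 0 k) L.
  have [kp|pk] := ltnP k (lead p); first by eexists; exact: zp.
  have [|a <-] := @color_of_onto _ _ Rm _ lead leadP p k.
    by rewrite pk (block_end_prev _ j0).
  by eexists; exact: bp.
have l0 := lambda_ge0 lead Rm_ge0 p.
have rat : (fun n => sc p n / sc j n) @ \oo --> (0 : R).
  have [_ lej _] := lead_prev leadP j0.
  move: lej; rewrite -/p le_eqVlt => /orP[/eqP E|ltj].
    rewrite (nu_eq leadP j0) -/p // -E; exact: cvg_scaleS_ratio.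
  rewrite (nu_lt leadP j0) -/p //; exact: cvg_scale_ratio.
apply: eq_asL2_cvg (asL2_cvgZ rat HL) => [n w|w]; last by rewrite mul0r.
have := sc_gt0 p n; have := sc_gt0 j n => s1 s2.
by field; rewrite !gt_eqF.
Qed.

Definition tie_factor j : R :=
  (nuj j)%:R^-1 * (pi_ (prev_block j) *m rho Rm lead (prev_block j)) 0 0.

(** The inflow has the scale of the previous block, one logarithm lower, and its limit pairs pi with
    the column rho; [scale_step_next] bridges the two scales. *)
Lemma lead_cvg_tie j Y : (0 < nuj j)%N -> below_negligible (prev_block j) ->
  block_cvg (prev_block j) Y ->
  asL2_cvg P (fun n w => (sc j n)^-1 * C n w 0 (lead j)) (fun w => tie_factor j * Y w).
Proof.
move=> nj zp bp; have [j0 lE nE] := nu_gt0 leadP nj.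
set p := prev_block j in zp bp lE nE *.
have l0 := lambda_ge0 lead Rm_ge0 j.
have [h1 h2] := scale_step_next (nuj p) l0.
pose Z w := \sum_(i | i != lead j) Rm i (lead j) * (block_coef p i * Y w).
have ZE w : Z w = (pi_ p *m rho Rm lead p) 0 0 * Y w.
  rewrite /Z; under eq_bigr do rewrite mulrA.
  rewrite -mulr_suml sum_block_coef ?(block_end_prev _ j0) //.
  congr (_ * _); rewrite mxE big_mkcond; apply: eq_bigr => a _.
  have [_] := color_ofE leadP a; rewrite (block_end_prev _ j0) => ->.
  by have [_ pE] := prev_blockK j0; rewrite [in RHS]mxE -/p pE.
have scj0 n : 0 < scale (lam j) (nuj p).+1 n by exact: scale_gt0.
have scp0 n : 0 < scale (lam j) (nuj p) n by exact: scale_gt0.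
have g0 (n : nat) : 0 < (n.+1%:R * harm n.+1)^-1 :> R.
  by rewrite invr_gt0 mulr_gt0 // harm_gt0.
have c0 : 0 < (nuj p).+1%:R :> R by [].
have H := urn_step_cvg Rm_ge0 Rm_row C0_gt0 urn (k := lead j)
  (Z := Z) scj0 scp0 g0 c0 h1 h2 cvg_series_invh.
rewrite nE; apply: eq_asL2_cvg (H _) => // [w|].
  by rewrite ZE /tie_factor nE -/p; ring.
apply: influx_asL2_cvg => i ij.
have [ia|ai] := ltnP i (lead j); last first.
  by left; apply: utR; rewrite ltn_neqAle ai eq_sym ij.
rewrite -lE; right; have [ip|pi] := ltnP i (lead p).
  apply: eq_asL2_cvg (zp i ip) => // w.
  by rewrite /block_coef leqNgt ip /= mul0r.
have [|b bE] := @color_of_onto _ _ Rm _ lead leadP p i.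
  by rewrite pi (block_end_prev _ j0).
by rewrite -bE; apply: eq_asL2_cvg (bp b) => // w; rewrite block_coef_color.
Qed.

(** In the functional given by [v] the smaller colors are negligible and the larger ones have
    coefficient 0, so its limit is that of the leading color. *)
Lemma lead_cvg_new j Y (v : 'I_K.+1 -> R) : nuj j = 0%N -> below_negligible j ->
  v (lead j) = 1 -> (forall m : 'I_K.+1, (lead j < m)%N -> v m = 0) ->
  asL2_cvg P (fun n w => (rise (lam j) n)^-1 * wsum C v n w) Y ->
  asL2_cvg P (fun n w => (sc j n)^-1 * C n w 0 (lead j)) Y.
Proof.
move=> nj zj v1 v0 HY.
have scE n : sc j n = rise (lam j) n by rewrite nj /scale expr0 mulr1.
have HZ : asL2_cvg P (fun n w => \sum_(i < K.+1 | (i < lead j)%N)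
    v i * ((sc j n)^-1 * C n w 0 i)) (fun w => \sum_(i < K.+1 | (i < lead j)%N) v i * 0).
  by apply: asL2_cvg_sum => i ij; apply: asL2_cvgZl; exact: zj.
apply: eq_asL2_cvg (asL2_cvgB HY HZ) => [n w|w]; last first.
  by rewrite big1 ?subr0 // => i _; rewrite mulr0.
rewrite -scE /wsum (bigD1 (lead j)) //= v1 mulr1 mulrDr -[RHS]addr0 -addrA.
congr (_ + _); apply/eqP; rewrite subr_eq0; apply/eqP.
rewrite mulr_sumr big_mkcond [RHS]big_mkcond /=; apply: eq_bigr => i _.
have [ij|ji|/val_inj->] := ltngtP i (lead j).
- by rewrite -val_eqE /= ltn_eqF // ; ring.
- by rewrite -val_eqE /= gtn_eqF // v0 // !mulr0.
- by rewrite eqxx.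
Qed.

End Assembly.

(** * From the exact scales to N^l (log N)^v *)

Definition rise_limit {R : realType} (l : R) : R :=
  limn (fun n => rise l n / n%:R `^ l).

Section RiseLimit.
Context {R : realType}.

Lemma cvg_rise_limit (l : R) : 0 <= l <= 1 ->
  (fun n => rise l n / n%:R `^ l) @ \oo --> rise_limit l.
Proof.
move=> l01; have [G _ HG] := cvg_rise l01.
by rewrite /rise_limit (cvg_lim _ HG).
Qed.

Lemma rise_limit_gt0 (l : R) : 0 <= l <= 1 -> 0 < rise_limit l.
Proof.
move=> l01; have [G G0 HG] := cvg_rise l01.
by rewrite /rise_limit (cvg_lim _ HG).
Qed.

(** The values at l = 0 and l = 1 are what makes V_1 = C_01 (when r_1 = 0) and V_(J+1) = 1 come out
    without a constant. *)
Lemma rise_limit0 : rise_limit 0 = 1 :> R.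
Proof.
rewrite /rise_limit (_ : (fun n => _) = cst 1); first exact: lim_cst.
by apply/funext => n; rewrite rise_exp0 powRr0 divr1.
Qed.

Lemma rise_limit1 : rise_limit 1 = 1 :> R.
Proof.
rewrite /rise_limit; apply: cvg_lim => //.
rewrite -(cvg_shiftS (fun n => rise 1 n / n%:R `^ 1)).
rewrite (_ : (fun n => _) = fun n => 1 + harmonic n).
  suff : (fun n => 1 + harmonic n : R) @ \oo --> (1 + 0 : R) by rewrite addr0.
  by apply: cvgD; [exact: cvg_cst|exact: cvg_harmonic].
apply/funext => n; rewrite rise1E powRr1 // -natr1 mulrDl divff ?pnatr_eq0 //.
by rewrite mul1r.
Qed.

Lemma cvg_scale_norming (l : R) v : 0 <= l <= 1 ->
  (fun n => (norming l v n)^-1 * scale l v n) @ \oo --> rise_limit l.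
Proof.
move=> l01; have h : (fun n => (harm n / ln n%:R) ^+ v : R) @ \oo --> (1 : R).
  elim: v => [|v IH].
    by under eq_fun do rewrite expr0; exact: cvg_cst.
  under eq_fun do rewrite exprS.
  suff : (fun n => harm n / ln n%:R * (harm n / ln n%:R) ^+ v : R) @ \oo --> (1 * 1 : R).
    by rewrite mulr1.
  by apply: cvgM => //; exact: cvg_harm_ln.
rewrite -(mulr1 (rise_limit l)).
rewrite (_ : (fun n => _) = fun n => rise l n / n%:R `^ l * (harm n / ln n%:R) ^+ v).
  by apply: cvgM => //; exact: cvg_rise_limit.
by apply/funext => n; rewrite /norming /scale invfM expr_div_n; ring.
Qed.

End RiseLimit.

Lemma cvg_row_entries {R : realType} n (x : nat -> 'rV[R]_n) (y : 'rV[R]_n) :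
  (forall i, (fun N => x N 0 i) @ \oo --> y 0 i) -> x @ \oo --> y.
Proof.
move=> xy; apply/cvg_ballP => e e0.
have H : \forall N \near \oo, forall i, ball (y 0 i) e (x N 0 i).
  by apply: filter_forall => i; have /cvg_ballP := xy i; exact.
by apply: filterS H => N HN; split => // i j; rewrite ord1.
Qed.

(** * Limits for the untied leading colors *)

Section Sources.
Context {d : measure_display} {T : measurableType d} {R : realType}.
Variables (P : probability T R) (K : nat) (Rm : 'M[R]_K.+1) (C0 : 'rV[R]_K.+1).
Variables (J : nat) (lead : 'I_J.+1 -> 'I_K.+1).
Variables (draw : nat -> T -> 'I_K.+1) (C : nat -> T -> 'rV[R]_K.+1).
Hypothesis K_gt0 : (1 <= K)%N.
Hypothesis utR : upper_triangular Rm.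
Hypothesis Rm_ge0 : forall i j, 0 <= Rm i j.
Hypothesis Rm_row : forall i, \sum_j Rm i j = 1.
Hypothesis C0_gt0 : forall i, 0 < C0 0 i.
Hypothesis C0_sum : \sum_i C0 0 i = 1.
Hypothesis leadP : running_maxima Rm lead.
Hypothesis urn : urn_process P Rm C0 draw C.
Implicit Types (j : 'I_J.+1) (Y : T -> R).

Local Notation lam := (lambda Rm lead).
Local Notation nuj := (nu Rm lead).

Definition lead_source j Y : Prop :=
  exists v : 'I_K.+1 -> R, [/\ v (lead j) = 1,
    forall m : 'I_K.+1, (lead j < m)%N -> v m = 0 &
    asL2_cvg P (fun n w => (rise (lam j) n)^-1 * wsum C v n w) Y].

(** All that the theorem asks of Y is gathered in one statement, so that a single choice over the
    blocks keeps it together. The functional is the total count for the last block, the constant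
    count of the first color if its diagonal entry is 0, and the eigenvector functional
    otherwise. *)
Lemma lead_source_exists j : exists Y,
  [/\ measurable_fun setT Y,
      nuj j = 0%N -> lead_source j Y,
      j = ord_max -> forall w, Y w = 1,
      j = ord0 -> lam j = 0 -> forall w, Y w = C0 0 ord0 &
      nuj j = 0%N -> (j < J)%N -> 0 < lam j -> nondegenerate_rv P Y].
Proof.
have [lead0 leadJ ldP] := leadP.
have J0 : (0 < J)%N.
  rewrite lt0n; apply/negP => /eqP J0.
  have E : ord0 = ord_max :> 'I_J.+1 by apply: val_inj; rewrite /= J0.
  by move: lead0; rewrite E leadJ => /(congr1 val) /= K0; move: K_gt0; rewrite K0.
have [->|jJ] := eqVneq j ord_max.
  exists (fun=> 1); split => //; last by rewrite ltnn.
  - move=> _; exists (fun=> 1); split => //.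
      by move=> m; rewrite leadJ /=; have := ltn_ord m; lia.
    have w1 n w : wsum C (fun=> 1) n w = n.+1%:R.
      elim: n => [|n IH].
        rewrite /wsum -[RHS]C0_sum; apply: eq_bigr => i _.
        by rewrite (urn_init urn) mulr1.
      rewrite (wsumS urn) IH -[in RHS]natr1; congr (_ + _).
      by rewrite /gain -[RHS](Rm_row (draw n w)); apply: eq_bigr => i _; rewrite mulr1.
    apply: eq_asL2_cvg (asL2_cvg_cst (L2_cst P 1)) => // n w.
    by rewrite (lambda_last utR Rm_row leadP) rise1E w1 mulVf // pnatr_eq0.
  - by move=> /(congr1 val) /= E; exfalso; move: J0; clear -E; lia.
have jltJ : (j < J)%N by have := ltn_ord j; move: jJ; rewrite -val_eqE /=; lia.
have [nj|nj] := eqVneq (nuj j) 0%N; last first.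
  (* A tied block inherits its limit from the previous one, so this is a placeholder, chosen to meet
     the clause for [ord0] outright. *)
  exists (fun=> C0 0 ord0); split => //.
  - by move=> n0; rewrite n0 in nj.
  - by move=> jE; rewrite jE eqxx in jJ.
  - by move=> n0; rewrite n0 in nj.
have [l0|l0] := eqVneq (lam j) 0.
  have [j0|j_neq0] := eqVneq j ord0.
    exists (fun=> C0 0 ord0); split => //; last by rewrite l0 ltxx.
    - move=> _; exists (ind_color ord0); split.
      + by rewrite j0 lead0 /ind_color eqxx.
      + by move=> m; rewrite j0 lead0 /= => m0; rewrite /ind_color -val_eqE /= gtn_eqF.
      + apply: eq_asL2_cvg (asL2_cvg_cst (L2_cst P (C0 0 ord0))) => // n w.
        rewrite l0 rise_exp0 invr1 mul1r wsum_ind_color.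
        elim: n => [|n IH]; first by rewrite (urn_init urn).
        rewrite (urn_step urn) !mxE -IH.
        have [d0|d0] := posnP (draw n w); last by rewrite utR ?addr0.
        rewrite (_ : draw n w = ord0); last exact: val_inj.
        by move: l0; rewrite j0 /lambda lead0 /diag => ->; rewrite addr0.
    - by move=> jE; rewrite jE eqxx in jJ.
  (* Impossible case: an untied later block with lambda = 0 would force a negative diagonal entry on
     the first color. *)
  have j_gt0 : (0 < j)%N by rewrite lt0n.
  have [pj _ _] := lead_prev leadP j_gt0.
  have := nu0_diag_lt leadP nj (m := ord0) (leq_ltn_trans (leq0n _) pj).
  by rewrite -/(diag Rm (lead j)) -/(lam j) l0 ltNge Rm_ge0.
have lgt0 : 0 < lam j by rewrite lt_neqAle eq_sym l0 lambda_ge0.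
have [v [v0 v1 vm ve]] := upper_eigenvector utR Rm_ge0 (fun m => nu0_diag_lt leadP nj).
have mu0 : 0 < \sum_i C0 0 i * v i.
  rewrite (bigD1 (lead j)) //= v1 mulr1 ltr_pwDl // sumr_ge0 // => i _.
  by rewrite mulr_ge0 // ltW.
have [Y HY] := eigen_asL2_cvg Rm_ge0 Rm_row C0_gt0 urn v0 (lambda_ge0 lead Rm_ge0 j) ve mu0.
exists Y; split => //.
- by have [_ YL _ _] := HY; exact: L2_measurable YL.
- by move=> _; exists v.
- by move=> jE; rewrite jE eqxx in jJ.
- by move=> _ l00; rewrite l00 eqxx in l0.
(* The last color supplies the zero of [v] on which nondegeneracy rests. *)
have vK : v ord_max = 0.
  apply: vm; have [jn _ _] := ldP j jltJ.
  by apply: leq_trans jn _; rewrite -ltnS.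
move=> _ _ _.
exact: (eigen_nondegenerate C0_gt0 urn (lambda_ge0 lead Rm_ge0 j) ve mu0 lgt0 vK HY).
Qed.
End Sources.

(** The recursion runs on a natural number because block indices are ordinals. An untied block
    restarts with its own Y, a tied one inherits; the first block is never tied, whence the base
    case. *)
Fixpoint limit_rec {R : realType} {T : Type} {J : nat} (Y : 'I_J.+1 -> T -> R)
    (f : 'I_J.+1 -> R) (fresh : pred 'I_J.+1) (n : nat) : T -> R :=
  if n is m.+1 then
    let j := inord n in
    if fresh j then Y j else fun w => f j * limit_rec Y f fresh m w
  else Y ord0.

Theorem theorem3p1 (d : measure_display) (T : measurableType d) (R : realType)
    (P : probability T R) (K : nat) (Rm : 'M[R]_K.+1) (C0 : 'rV[R]_K.+1)
    (J : nat) (lead : 'I_J.+1 -> 'I_K.+1)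
    (draw : nat -> T -> 'I_K.+1) (C : nat -> T -> 'rV[R]_K.+1) :
  (1 <= K)%N ->
  upper_triangular Rm ->
  (forall i j, 0 <= Rm i j) ->
  (forall i, \sum_j Rm i j = 1) ->
  (forall i, 0 < C0 0 i) ->
  \sum_i C0 0 i = 1 ->
  running_maxima Rm lead ->
  increasing_order Rm lead ->
  linked_ties Rm lead ->
  urn_process P Rm C0 draw C ->
  exists V : 'I_J.+1 -> {RV P >-> R},
    (forall j : 'I_J.+1,
      {ae P, forall w,
        (norming (lambda Rm lead j) (nu Rm lead j) N)^-1
          *: block_part lead j (C N w) @[N --> \oo]
        --> V j w *: block_pi Rm lead j} /\
      (forall a : 'I_(block_pred lead j).+1,
        cvg_L2 P
          (fun N w => (norming (lambda Rm lead j) (nu Rm lead j) N)^-1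
                        * block_part lead j (C N w) 0 a)
          (fun w => V j w * block_pi Rm lead j 0 a))) /\
    (forall w, V ord_max w = 1) /\
    (diag Rm ord0 = 0 -> forall w, V ord0 w = C0 0 ord0) /\
    (0 < diag Rm ord0 -> nondegenerate_rv P (V ord0)) /\
    (forall j : 'I_J.+1, (0 < j < J)%N -> nu Rm lead j = 0%N ->
      nondegenerate_rv P (V j)) /\
    (forall j : 'I_J.+1, (0 < j < J)%N -> (0 < nu Rm lead j)%N ->
      forall w, V j w =
        (nu Rm lead j)%:R^-1
        * (block_pi Rm lead (prev_block j) *m rho Rm lead (prev_block j)) 0 0
        * V (prev_block j) w).
Proof.
move=> K0 utR Rm0 Rm1 C0p C0s leadP incr ties urn.
pose lam := lambda Rm lead; pose nuj := nu Rm lead.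
have lam01 j : 0 <= lam j <= 1 by rewrite lambda_ge0 ?lambda_le1.
have /choice[Y HY] := lead_source_exists K0 utR Rm0 Rm1 C0p C0s leadP urn.
pose ch := limit_rec Y (tie_factor Rm lead) (fun j => nuj j == 0%N).
have chE (j : 'I_J.+1) : (0 < j)%N -> ch j = if nuj j == 0%N then Y j
    else fun w => tie_factor Rm lead j * ch (prev_block j) w.
  move=> j0; have pE : prev_block j = j.-1 :> nat.
    by rewrite /prev_block inordK //; have := ltn_ord j; lia.
  rewrite pE; case: j j0 pE => -[|m] jm //= _ _.
  by rewrite /ch /= (_ : inord m.+1 = Ordinal jm) //; apply: val_inj; rewrite /= inordK.
have new (j : 'I_J.+1) (nj : nuj j = 0%N) : ch j = Y j.
  have [j0|j0] := posnP j; last by rewrite chE // nj.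
  by rewrite (_ : j = ord0) //; exact: val_inj.
have tie (j : 'I_J.+1) (nj : (0 < nuj j)%N) :
    ch j = fun w => tie_factor Rm lead j * ch (prev_block j) w.
  by have [j0 _ _] := nu_gt0 leadP nj; rewrite chE // gtn_eqF.
have main (j : 'I_J.+1) : below_negligible P Rm lead C j /\ block_cvg P Rm lead C j (ch j).
  suff lead_ok i : below_negligible P Rm lead C i ->
      ((0 < nuj i)%N -> below_negligible P Rm lead C (prev_block i) /\
         block_cvg P Rm lead C (prev_block i) (ch (prev_block i))) ->
      block_cvg P Rm lead C i (ch i).
    elim/(@block_ind J) : j => [|j j0 [zp bp]].
      have z0 : below_negligible P Rm lead C ord0.
        by move=> k; have [-> _ _] := leadP; rewrite ltn0.
      by split => //; apply: lead_ok => //; rewrite /nuj (nu_ord0 leadP).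
    have zj := below_negligible_next Rm0 leadP j0 zp bp.
    by split => //; exact: lead_ok.
  move=> zi hp; apply: (block_cvg_of_lead utR Rm0 Rm1 C0p leadP urn) => //.
  have [ni|ni] := posnP (nuj i).
    rewrite new //; have [_ /(_ ni)[v [v1 vm HvY]] _ _ _] := HY i.
    exact: lead_cvg_new ni zi v1 vm HvY.
  by rewrite tie //; have [zp bp] := hp ni; exact: (lead_cvg_tie utR Rm0 Rm1 C0p leadP urn).
(* Measurability is read off the limit at the leading coordinate, where pi is 1. *)
have mch (j : 'I_J.+1) : measurable_fun setT (ch j).
  have [_ /(_ ord0)[_ + _ _]] := main j.
  have [_ ->] := is_pi_block_pi utR leadP j.
  by under eq_fun do rewrite mul1r; exact: L2_measurable.
pose V0 (j : 'I_J.+1) w := rise_limit (lam j) * ch j w.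
have mV j : V0 j \in (mfun : {pred T -> R}).
  by rewrite inE /=; exact: measurable_funM.
have cvgV j a : asL2_cvg P (fun N w => (norming (lam j) (nuj j) N)^-1
      * block_part lead j (C N w) 0 a)
    (fun w => V0 j w * block_pi Rm lead j 0 a).
  have [_ /(_ a) bj] := main j.
  apply: eq_asL2_cvg (asL2_cvgZ (cvg_scale_norming (nuj j) (lam01 j)) bj) => [n w|w].
    rewrite mxE -mulrA; congr (_ * _); rewrite mulrA divff ?mul1r //.
    by rewrite gt_eqF // scale_gt0 // lambda_ge0.
  by rewrite /V0; ring.
exists (fun j => mfun_Sub (mV j)).
have VE j w : mfun_Sub (mV j) w = V0 j w by [].
have nondeg (j : 'I_J.+1) : nuj j = 0%N -> nondegenerate_rv P (Y j) ->
    nondegenerate_rv P (mfun_Sub (mV j)).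
  move=> nj nd [c Hc]; apply: nd; exists (c / rise_limit (lam j)).
  have G0 : rise_limit (lam j) != 0 by rewrite gt_eqF // rise_limit_gt0.
  by apply: filterS Hc => w; rewrite VE /V0 new // => <-; rewrite mulrAC divff ?mul1r.
split; [|split; [|split; [|split; [|split]]]].
- move=> j; split; last by move=> a; exact: asL2_cvg_L2 (cvgV j a).
  have H : {ae P, forall w, forall a, (norming (lam j) (nuj j) N)^-1
      * block_part lead j (C N w) 0 a @[N --> \oo] --> V0 j w * block_pi Rm lead j 0 a}.
    by apply: filter_forall => a; have [_ _ + _] := cvgV j a.
  apply: filterS H => w Hw; apply: cvg_row_entries => a.
  have -> : (mfun_Sub (mV j) w *: block_pi Rm lead j) 0 a =
      V0 j w * block_pi Rm lead j 0 a by rewrite mxE.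
  by apply: cvg_trans (Hw a); apply: near_eq_cvg; apply: nearW => N; rewrite !mxE.
- move=> w; rewrite VE /V0 new; last first.
    apply/eqP; rewrite -leqn0 leqNgt; apply/negP => nJ.
    (* A tie at the last block would give the block before it lambda = 1. *)
    have [/prev_blockK[pJ _] lE _] := nu_gt0 leadP nJ.
    have := lambda_lt1 Rm0 Rm1 leadP incr ties pJ.
    by rewrite lE (lambda_last utR Rm1 leadP) ltxx.
  have [_ _ -> // _ _] := HY ord_max.
  by rewrite /lam (lambda_last utR Rm1 leadP) rise_limit1 mulr1.
- move=> d0 w; rewrite VE /V0; have l0 : lam ord0 = 0.
    by rewrite /lam /lambda; have [-> _ _] := leadP.
  rewrite l0 rise_limit0 mul1r new; last exact: nu_ord0 leadP.
  have [_ _ _ -> // _] := HY ord0.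
- move=> d0; have l0 : 0 < lam ord0 by rewrite /lam /lambda; have [-> _ _] := leadP.
  have J0 : (0 < J)%N.
    rewrite lt0n; apply/negP => /eqP J0; have [lead0 leadJ _] := leadP.
    have E : ord0 = ord_max :> 'I_J.+1 by apply: val_inj; rewrite /= J0.
    by move: lead0 K0; rewrite E leadJ => /(congr1 val) /= ->.
  have n0 : nuj ord0 = 0%N by exact: nu_ord0 leadP.
  apply: nondeg => //; have [_ _ _ _] := HY ord0; exact.
- move=> j /andP[j0 jJ] nj; apply: nondeg => //.
  have [_ _ _ _] := HY j; apply => //.
  (* Without a tie lambda_j lies strictly above the previous value, which is nonnegative; so it is
     positive. *)
  have [_ lej _] := lead_prev leadP j0.
  apply: (@le_lt_trans _ _ (lam (prev_block j))); first exact: lambda_ge0.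
  rewrite lt_neqAle lej andbT; apply/negP => /eqP E.
  by have := nu_eq leadP j0 E; rewrite nj.
- move=> j /andP[j0 jJ] nj w; rewrite !VE /V0 tie //.
  have [_ lE _] := nu_gt0 leadP nj.
  (* Equal exponents have equal [rise_limit], so the relation passes from [ch] to V unchanged. *)
  rewrite /lam -lE /tie_factor -/nuj; ring.
Qed.
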